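(* Let $N\ge 1$ be an integer, let $\theta_1^0,\dots,\theta_N^0\in\mathbb{R}$ be such that $R^0>0$, where $R^0=\left|\frac1N\sum_{j=1}^N e^{\mathrm{i}\theta_j^0}\right|$, and let $\varepsilon>0$. Then there exist numbers $a,b,c>0$, depending only on $\theta_1^0,\dots,\theta_N^0$ and $\varepsilon$, such that the following holds. If $\omega_1^0,\dots,\omega_N^0\in\mathbb{R}$, $\kappa>0$, $m>0$ and $\nu_1,\dots,\nu_N\in\mathbb{R}$ satisfy $$\frac{\max_{i,j\in[N]}|\nu_i-\nu_j|}{\kappa}<a,\qquad \frac{\max_{i,j\in[N]}|\omega_i^0-\omega_j^0|}{\kappa}<b,\qquad m\kappa<c,$$ then the solution $\theta_1(t),\dots,\theta_N(t)$, $t\ge0$, of the inertial Kuramoto Cauchy problem $$m\ddot\theta_i+\dot\theta_i=\nu_i+\frac{\kappa}{N}\sum_{j=1}^N\sin(\theta_j-\theta_i),\qquad \theta_i(0)=\theta_i^0,\quad \dot\theta_i(0)=\omega_i^0,\qquad i\in[N],$$ achieves asymptotic phase-locking: there exist $\theta_1^\infty,\dots,\theta_N^\infty\in\mathbb{R}$ such that $$\lim_{t\to\infty}\left(\theta_i(t)-\frac{t}{N}\sum_{j=1}^N\nu_j\right)=\theta_i^\infty,\qquad \lim_{t\to\infty}\dot\theta_i(t)=\frac1N\sum_{j=1}^N\nu_j,\qquad i=1,\dots,N.$$ Furthermore, with $R(t)=\left|\frac1N\sum_{j=1}^N e^{\mathrm{i}\theta_j(t)}\right|$, the limiting order parameter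 satisfies $$\lim_{t\to\infty}R(t)>\begin{cases}1-\varepsilon & \text{if } N=2,\\ 1-\frac2N-\varepsilon & \text{if } N=3 \text{ or } \theta_i^0\not\equiv\theta_j^0 \ (\mathrm{mod}\ 2\pi)\text{ for all } i\ne j \text{ in } [N],\\ R^0-\varepsilon & \text{otherwise.}\end{cases}$$
   Context: $[N]=\{1,\dots,N\}$. The cases in the lower bound are read in order (the first applicable case applies). The Cauchy problem has a unique global real-analytic solution. *)

(* Defs.v *)
From HB Require Import structures.
From mathcomp Require Import all_boot all_order all_algebra.
From mathcomp Require Import all_classical all_reals all_analysis.
From mathcomp Require Import complex.
Set Implicit Arguments.
Unset Strict Implicit.
Unset Printing Implicit Defensive.
Import Order.TTheory GRing.Theory Num.Theory.
Import numFieldNormedType.Exports.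
Local Open Scope classical_set_scope.
Local Open Scope complex_scope.
Local Open Scope ring_scope.

(* The values are >= 0, so the default value 0 of the iterated maximum is
   harmless. *)
Definition max_diff (R : realType) (N : nat) (x : 'I_N -> R) : R :=
  \big[Num.max/0]_(i < N) \big[Num.max/0]_(j < N) `|x i - x j|.

Definition expi (R : realType) (x : R) : R[i] := cos x +i* sin x.

(* [normc] is the R-valued modulus; the generic norm of R[i] is R[i]-valued. *)
Definition order_param (R : realType) (N : nat) (theta : 'I_N -> R) : R :=
  ComplexField.Normc.normc (N%:R^-1 * \sum_(j < N) expi (theta j)).

Definition eq_mod_2pi (R : realType) (x y : R) : Prop :=
  exists k : int, x = y + k%:~R * (2 * pi).

(* df is the derivative of f on [0, +oo[, one-sided at 0; the values of f at
   negative times are irrelevant. *)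
Definition derivative_on_ge0 (R : realType) (f df : R -> R) : Prop :=
  (forall t : R, 0 < t -> is_derive t 1 f (df t)) /\
  h^-1 * (f h - f 0) @[h --> 0^'+] --> df 0.

Record kuramoto_solution (R : realType) (N : nat) (m kappa : R)
    (nu theta0 omega0 : 'I_N -> R) (theta dtheta ddtheta : 'I_N -> R -> R) :
    Prop := KuramotoSolution {
  kuramoto_dtheta : forall i : 'I_N, derivative_on_ge0 (theta i) (dtheta i);
  kuramoto_ddtheta : forall i : 'I_N, derivative_on_ge0 (dtheta i) (ddtheta i);
  kuramoto_ode : forall (i : 'I_N) (t : R), 0 <= t ->
    m * ddtheta i t + dtheta i t =
    nu i + kappa / N%:R * \sum_(j < N) sin (theta j t - theta i t);
  kuramoto_theta0 : forall i : 'I_N, theta i 0 = theta0 i;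
  kuramoto_omega0 : forall i : 'I_N, dtheta i 0 = omega0 i
}.

Definition order_param_bound (R : realType) (N : nat) (theta0 : 'I_N -> R)
    (eps : R) : R :=
  if N == 2%N then 1 - eps
  else if (N == 3%N) ||
          `[< forall i j : 'I_N, i != j -> ~ eq_mod_2pi (theta0 i) (theta0 j) >]
  then 1 - 2 / N%:R - eps
  else order_param theta0 - eps.

(* Main.v *)
Require Import Defs.
From mathcomp Require Import all_boot all_order all_algebra.
From mathcomp Require Import all_classical all_reals all_analysis.
From mathcomp Require Import complex ring lra.
Set Implicit Arguments.
Unset Strict Implicit.
Unset Printing Implicit Defensive.
Import Order.TTheory GRing.Theory Num.Theory.
Import numFieldNormedType.Exports.
Local Open Scope classical_set_scope.
Local Open Scope ring_scope.

(** In the time scale [kappa t] and in the frame of the mean phase, with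
    [mu = m kappa], the energy [W = N R^2 / 2 - mu/2 sum v_i^2] grows at rate
    [sum v_i^2] up to small frequency terms [sum p_i v_i].  If at some time an
    oscillator is pulled strongly, [W] gains a fixed amount during a fixed
    time.  While all pulls are weak and [R] stays away from 0, every
    oscillator is close to the mean phase or to its opposite, so phases cannot
    move much and the loss of [W] is negligible.  As [W <= N / 2], only
    finitely many gains occur and the pulls are eventually weak for ever; [W]
    never falls noticeably, which keeps [R] above [R^0 - eps].

    The energy then converges, so velocities and accelerations vanish
    (Barbalat), the pulls converge, and [R], a fixed point of a contraction
    depending on the pulls, converges; hence so do the phases.  With [k]
    oscillators opposite to the mean phase, [R] is close to [1 - 2 k / N].

    For distinct initial phases, [sin^2] of half the difference of two phases
    decays at most exponentially, but grows exponentially while both are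
    opposite to the mean phase.  So a window of weak pulls with [k >= 2] has
    bounded length, and since there are boundedly many gains, a time with
    [k <= 1] is reached before small perturbations matter. *)

(** * Real analysis *)

Section PointwiseDerivatives.
Context (R : realType).
Implicit Types (f g : R -> R) (t a b l e : R).

Lemma is_derive_cstE t a : is_derive t 1 (fun _ : R => a) 0.
Proof. exact: is_derive_cst. Qed.

Lemma is_derive_idE t : is_derive t 1 (fun s : R => s) 1.
Proof. exact: is_derive_id. Qed.

Lemma is_derive_add f g t a b : is_derive t 1 f a -> is_derive t 1 g b ->
  is_derive t 1 (fun s => f s + g s) (a + b).
Proof. by move=> ? ?; exact: is_deriveD. Qed.

Lemma is_derive_opp f t a : is_derive t 1 f a ->
  is_derive t 1 (fun s => - f s) (- a).
Proof. by move=> ?; exact: is_deriveN. Qed.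

Lemma is_derive_mul f g t a b : is_derive t 1 f a -> is_derive t 1 g b ->
  is_derive t 1 (fun s => f s * g s) (a * g t + f t * b).
Proof.
move=> df dg; apply: (@is_derive_eq _ _ _ _ _ _ _ _ (is_deriveM df dg)).
by rewrite !/GRing.scale /= addrC (mulrC (g t)).
Qed.

Lemma is_derive_mulc f t a b : is_derive t 1 f a ->
  is_derive t 1 (fun s => b * f s) (b * a).
Proof. by move=> df; exact: (is_deriveZ b df). Qed.

Lemma is_derive_sumE n (F : 'I_n -> R -> R) (dF : 'I_n -> R) t :
  (forall i, is_derive t 1 (F i) (dF i)) ->
  is_derive t 1 (fun s => \sum_i F i s) (\sum_i dF i).
Proof.
move=> dFP; have := is_derive_sum dFP.
by have -> : \sum_i F i = (fun s => \sum_i F i s)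
  by apply/funext => s; rewrite fct_sumE.
Qed.

Lemma is_derive_sinf f t a : is_derive t 1 f a ->
  is_derive t 1 (fun s => sin (f s)) (a * cos (f t)).
Proof.
move=> df; apply: (@is_derive_eq _ _ _ _ _ _ _ _
  (is_derive1_comp (is_derive_sin (f t)) df)).
by rewrite /GRing.scale /= mulrC.
Qed.

Lemma is_derive_cosf f t a : is_derive t 1 f a ->
  is_derive t 1 (fun s => cos (f s)) (- (a * sin (f t))).
Proof.
move=> df; apply: (@is_derive_eq _ _ _ _ _ _ _ _
  (is_derive1_comp (is_derive_cos (f t)) df)).
by rewrite /GRing.scale /= mulNr mulrC.
Qed.

Lemma is_derive_expRc t a :
  is_derive t 1 (fun s => expR (a * s)) (a * expR (a * t)).
Proof.
have da : is_derive t 1 (fun s : R => a * s) a.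
  apply: (@is_derive_eq _ _ _ _ _ _ _ _ (is_derive_mulc a (is_derive_idE t))).
  by rewrite mulr1.
apply: (@is_derive_eq _ _ _ _ _ _ _ _
  (is_derive1_comp (is_derive_expR (a * t)) da)).
by rewrite /GRing.scale /= mulrC.
Qed.

Lemma is_derive_affine f t a b c : is_derive (c + t * b) 1 f a ->
  is_derive t 1 (fun s => f (c + s * b)) (b * a).
Proof.
move=> df.
have db : is_derive t 1 (fun s : R => c + s * b) b.
  have := is_derive_add (is_derive_cstE t c)
    (is_derive_mul (is_derive_idE t) (is_derive_cstE t b)).
  by rewrite mulr0 addr0 mul1r add0r.
apply: (@is_derive_eq _ _ _ _ _ _ _ _ 
  (@is_derive1_comp _ f (fun s => c + s * b) t a b df db)).
by rewrite /GRing.scale /= mulrC.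
Qed.

Lemma is_derive_continuous f t a : is_derive t 1 f a -> {for t, continuous f}.
Proof. by case=> df _; exact/differentiable_continuous/derivable1_diffP. Qed.

Lemma mean_value f df a b : a <= b ->
  (forall t, a <= t <= b -> is_derive t 1 f (df t)) ->
  exists2 c, a <= c <= b & f b - f a = df c * (b - a).
Proof.
move=> ab fP.
have [t|t|c] := @MVT_segment R f df a b ab.
- by rewrite in_itv /= => /andP[/ltW at_ /ltW tb]; apply: fP; rewrite at_.
- apply: continuous_in_subspaceT => x; rewrite inE/= in_itv /= => xab.
  exact: is_derive_continuous (fP _ xab).
- by rewrite in_itv /= => cab ->; exists c.
Qed.

Lemma derive_ge0_le f df a b : a <= b ->
  (forall t, a <= t <= b -> is_derive t 1 f (df t)) ->
  (forall t, a <= t <= b -> 0 <= df t) -> f a <= f b.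
Proof.
move=> ab fP df0; rewrite -subr_ge0; have [c cab ->] := mean_value ab fP.
by rewrite mulr_ge0 ?df0 ?subr_ge0.
Qed.

Lemma derive_ge_ler f df a b K : a <= b ->
  (forall t, a <= t <= b -> is_derive t 1 f (df t)) ->
  (forall t, a <= t <= b -> K <= df t) -> K * (b - a) <= f b - f a.
Proof.
move=> ab fP dfK; have [c cab ->] := mean_value ab fP.
by rewrite ler_wpM2r ?subr_ge0 ?dfK.
Qed.

Lemma derive_bounded_lipschitz f df a b K : a <= b ->
  (forall t, a <= t <= b -> is_derive t 1 f (df t)) ->
  (forall t, a <= t <= b -> `|df t| <= K) -> `|f b - f a| <= K * (b - a).
Proof.
move=> ab fP dfK; have [c cab ->] := mean_value ab fP.
by rewrite normrM (ger0_norm (_ : 0 <= b - a)) ?ler_wpM2r ?subr_ge0 ?dfK.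
Qed.

Lemma sin_lipschitz a b : `|sin a - sin b| <= `|a - b|.
Proof.
wlog ab : a b / b <= a.
  by move=> H; case: (leP b a) => [|/ltW ba]; [exact: H|rewrite distrC (distrC a); exact: H].
rewrite (ger0_norm (_ : 0 <= a - b)) ?subr_ge0 //.
have := @derive_bounded_lipschitz sin cos b a 1 ab.
by rewrite mul1r; apply=> t _; exact: cos_max.
Qed.

Lemma cos_lipschitz a b : `|cos a - cos b| <= `|a - b|.
Proof.
wlog ab : a b / b <= a.
  by move=> H; case: (leP b a) => [|/ltW ba]; [exact: H|rewrite distrC (distrC a); exact: H].
rewrite (ger0_norm (_ : 0 <= a - b)) ?subr_ge0 //.
have := @derive_bounded_lipschitz cos (fun t => - sin t) b a 1 ab.
rewrite mul1r; apply=> t _.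
by rewrite normrN sin_max.
Qed.

Lemma sin_abs_le a : `|sin a| <= `|a|.
Proof. by have := sin_lipschitz a 0; rewrite sin0 !subr0. Qed.

(* By the intermediate value theorem, f cannot leave the neighbourhood
   ]f a - e, f a + e[ without |sin (f - f a)| reaching sin e. *)
Lemma sin_confinement f a b e : a <= b -> 0 < e < pi ->
  (forall t, a <= t <= b -> {for t, continuous f}) ->
  (forall t, a <= t <= b -> `|sin (f t - f a)| < sin e) -> `|f b - f a| < e.
Proof.
move=> ab /andP[e0 epi] fc fs; rewrite ltNge; apply/negP => feb.
have fcw : {within `[a, b], continuous f}.
  apply: continuous_in_subspaceT => x; rewrite inE/= in_itv /= => xab.
  exact: fc.
have sine0 : 0 < sin e by rewrite sin_gt0_pi ?e0.
case: (lerP (f a) (f b)) => fab.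
  have [|c] := @IVT R f a b (f a + e) ab fcw.
    rewrite (min_idPl fab) (max_idPr fab) lerDl ltW //=.
    by move: feb; rewrite ger0_norm ?subr_ge0 // lerBrDl.
  rewrite in_itv /= => /fs + fce; rewrite fce addrC addKr.
  by rewrite gtr0_norm // ltxx.
have [|c] := @IVT R f a b (f a - e) ab fcw.
  rewrite (min_idPr (ltW fab)) (max_idPl (ltW fab)) lerBlDl lerDr (ltW e0) andbT.
  by move: feb; rewrite ltr0_norm ?subr_lt0 // opprB; lra.
rewrite in_itv /= => /fs + fce; rewrite fce addrC addKr.
by rewrite sinN normrN gtr0_norm // ltxx.
Qed.

(** Intermediate value theorem. Applied to [align], it shows that the set of oscillators opposite to
    the mean phase cannot change during a locked window. *)
Lemma continuous_neq0_pos f a b : a <= b ->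
  (forall t, a <= t <= b -> {for t, continuous f}) ->
  (forall t, a <= t <= b -> f t != 0) -> (0 < f a) = (0 < f b).
Proof.
move=> ab fc f0.
have fcw : {within `[a, b], continuous f}.
  apply: continuous_in_subspaceT => x; rewrite inE/= in_itv /= => xab.
  exact: fc.
have fa0 : f a != 0 by rewrite f0 ?lexx.
have fb0 : f b != 0 by rewrite f0 ?lexx ?ab.
have [fa|fa|fa] := ltgtP 0 (f a); last by rewrite -fa eqxx in fa0.
- apply/esym; rewrite lt_neqAle eq_sym fb0 /= leNgt; apply/negP => fb.
  have [|c] := @IVT R f a b 0 ab fcw.
    by rewrite (min_idPr _) ?(max_idPl _) ?ltW //; lra.
  by rewrite in_itv /= => /f0 /eqP.
- apply/esym/negP => fb.
  have [|c] := @IVT R f a b 0 ab fcw.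
    by rewrite (min_idPl _) ?(max_idPr _) ?ltW //; lra.
  by rewrite in_itv /= => /f0 /eqP.
Qed.

(** * Limits at infinity *)

Definition cauchy_at_infty f := forall e, 0 < e ->
  exists2 T, 0 <= T & forall t s, T <= t -> T <= s -> `|f t - f s| <= e.

Lemma cauchy_at_infty_cvg f : cauchy_at_infty f ->
  exists l : R, f t @[t --> +oo] --> l.
Proof.
move=> fC; suff : cvg (f x @[x --> +oo%R]) by move=> /cvg_ex.
apply/cauchy_cvgP/cauchy_exP => e e0.
have [T T0 fT] := fC _ (divr_gt0 e0 (ltr0n _ 2)).
exists (f T); suff : \forall t \near +oo%R, ball (f T) e (f t) by [].
near=> t; rewrite /ball /=.
apply: (@le_lt_trans _ _ (e / 2)); last by rewrite gtr_pMr // invf_lt1 // ltr1n.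
by apply: fT => //; near: t; exact: nbhs_pinfty_ge.
Unshelve. all: by end_near. Qed.

Lemma cvg_at_infty_le f l e : f t @[t --> +oo] --> l -> 0 < e ->
  exists2 T, 0 <= T & forall t, T <= t -> `|f t - l| <= e.
Proof.
move=> /cvgrPdistC_le fl e0; have [T [_ fT]] := fl _ e0.
exists (Num.max 0 (T + 1)); first by rewrite le_max lexx.
move=> t; rewrite ge_max => /andP[_ Tt]; apply: fT.
by apply: lt_le_trans Tt; rewrite ltrDl.
Qed.

Lemma le_cvg_at_infty f l :
  (forall e, 0 < e -> exists2 T, 0 <= T & forall t, T <= t -> `|f t - l| <= e) ->
  f t @[t --> +oo] --> l.
Proof.
move=> fl; apply/cvgrPdistC_le => e e0; have [T T0 fT] := fl _ e0.
by near=> t; rewrite fT //; near: t; exact: nbhs_pinfty_ge.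
Unshelve. all: by end_near. Qed.

Lemma eq_cvg_at_infty f g l t0 : (forall t, t0 <= t -> f t = g t) ->
  f t @[t --> +oo] --> l -> g t @[t --> +oo] --> l.
Proof.
move=> fg fl; apply: le_cvg_at_infty => e e0.
have [T T0 fT] := cvg_at_infty_le fl e0.
exists (Num.max T t0); first by rewrite le_max T0.
by move=> t; rewrite ge_max => /andP[Tt t0t]; rewrite -fg // fT.
Qed.

Lemma cvg_cauchy_at_infty f l : f t @[t --> +oo] --> l -> cauchy_at_infty f.
Proof.
move=> fl e e0; have [T T0 fT] := cvg_at_infty_le fl (divr_gt0 e0 (ltr0n _ 2)).
exists T => // t s /fT ft /fT fs.
rewrite [e]splitr -(subrK l (f t)) -addrA (le_trans (ler_normD _ _)) //.
by rewrite lerD // distrC.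
Qed.

Lemma nondecreasing_bounded_cauchy f t0 M : 0 <= t0 ->
  (forall t s, t0 <= t -> t <= s -> f t <= f s) ->
  (forall t, t0 <= t -> f t <= M) -> cauchy_at_infty f.
Proof.
move=> t00 fnd fM e e0; apply/not_exists2P => fN.
have step k : exists2 t, t0 <= t & f t0 + k%:R * e <= f t.
  elim: k => [|k [t t0t ft]]; first by exists t0; rewrite // mul0r addr0.
  have [//|/existsNP[u /existsNP[s]]] := fN t.
    by move=> H; exfalso; apply: H; exact: le_trans t00 t0t.
  move=> /not_implyP[tu /not_implyP[ts /negP]]; rewrite -ltNge => eus.
  wlog us : u s tu ts eus / u <= s.
    move=> H; case: (lerP u s) => [|/ltW]; first exact: H.
    by apply: (H s u) => //; rewrite distrC.
  exists s; first exact: le_trans ts.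
  have fus := fnd _ _ (le_trans t0t tu) us.
  have ftu := fnd _ _ t0t tu.
  move: eus; rewrite distrC ger0_norm ?subr_ge0 // => eus.
  by rewrite -natr1 mulrDl mul1r; lra.
have [t t0t ft] := step (Num.truncn ((M - f t0) / e)).+1.
have := fM _ t0t; have : (M - f t0) < (Num.truncn ((M - f t0) / e)).+1%:R * e.
  by rewrite -ltr_pdivrMr // truncnS_gt.
by lra.
Qed.

(* Barbalat's lemma. *)
Lemma cauchy_lipschitz_derivative f g t0 K : 0 < K -> 0 <= t0 ->
  (forall t, t0 <= t -> is_derive t 1 f (g t)) ->
  (forall t s, t0 <= t -> t <= s -> `|g s - g t| <= K * (s - t)) ->
  cauchy_at_infty f -> g t @[t --> +oo] --> (0 : R).
Proof.
move=> K0 t00 fg gK fC; apply: le_cvg_at_infty => e e0.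
(* Within a time [h] the derivative changes by at most [e / 2], and the small increment of [f]
   bounds it by [e / 2] at some point of the window. *)
pose h := e / (2 * K).
have h0 : 0 < h by rewrite divr_gt0 // mulr_gt0.
have Kh : K * h = e / 2 by rewrite /h invfM; field; rewrite gt_eqF.
have [T T0 fT] := fC (h * e / 2) (divr_gt0 (mulr_gt0 h0 e0) (ltr0n _ 2)).
exists (Num.max T t0); first by rewrite le_max T0.
move=> t; rewrite ge_max => /andP[Tt t0t]; rewrite subr0.
have tth : t <= t + h by rewrite lerDl ltW.
have [|c /andP[tc cth] fc] := @mean_value f g t (t + h) tth.
  by move=> s /andP[ts _]; apply: fg; exact: le_trans ts.
have := fT _ _ (le_trans Tt tth) Tt.
rewrite fc addrC addKr normrM (gtr0_norm h0) => gch.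
have {}gch : `|g c| <= e / 2.
  rewrite -(ler_pM2r h0) (le_trans gch) //.
  by rewrite (_ : h * e / 2 = e / 2 * h) //; ring.
have gct : `|g c - g t| <= e / 2.
  rewrite (le_trans (gK _ _ t0t tc)) // -Kh ler_pM2l //.
  by rewrite lerBlDl.
rewrite -(subKr (g c) (g t)) [e]splitr (le_trans (ler_normB _ _)) // lerD //.
Qed.

End PointwiseDerivatives.

(** * Phase configurations *)

Section Configurations.
Context (R : realType) (N : nat).
Hypothesis N_gt0 : (0 < N)%N.
Implicit Types (z w : 'I_N -> R) (i j : 'I_N) (r s : R).

Definition mean_cos z : R := N%:R^-1 * \sum_j cos (z j).
Definition mean_sin z : R := N%:R^-1 * \sum_j sin (z j).

(* With mean_cos z + i mean_sin z = r e^{i phi}, these are r sin (phi - z i)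
   and r cos (phi - z i). *)
Definition pull z i : R := mean_sin z * cos (z i) - mean_cos z * sin (z i).
Definition align z i : R := mean_cos z * cos (z i) + mean_sin z * sin (z i).

(** Small pulls alone would admit incoherent states, where every pull is small because the order
    parameter is; the lower bound [r] excludes them. *)
Definition near_locked s r z :=
  (forall i, `|pull z i| <= s) /\ r <= order_param z.

Lemma natN_gt0 : 0 < N%:R :> R. Proof. by rewrite ltr0n. Qed.
Lemma natN_neq0 : N%:R != 0 :> R. Proof. by rewrite gt_eqF ?natN_gt0. Qed.

Lemma order_paramE z : order_param z = Num.sqrt (mean_cos z ^+ 2 + mean_sin z ^+ 2).
Proof.
have expi_sum : \sum_j expi (z j) =
    ((\sum_j cos (z j)) +i* (\sum_j sin (z j)))%C.
  elim/big_rec3: _ => //= i a b c _ ->.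
  by rewrite /expi; simpc.
rewrite /order_param expi_sum.
have -> : (N%:R^-1 : R[i]) = ((N%:R^-1 : R)%:C)%C.
  by rewrite fmorphV rmorph_nat.
by simpc; rewrite /ComplexField.Normc.normc.
Qed.

Lemma order_param_ge0 z : 0 <= order_param z.
Proof. by rewrite order_paramE sqrtr_ge0. Qed.

Lemma order_param_sqr z : order_param z ^+ 2 = mean_cos z ^+ 2 + mean_sin z ^+ 2.
Proof. by rewrite order_paramE sqr_sqrtr // addr_ge0 // sqr_ge0. Qed.

Lemma pull_align z i : pull z i ^+ 2 + align z i ^+ 2 = order_param z ^+ 2.
Proof.
rewrite order_param_sqr /pull /align.
have -> : forall a b c d : R, (a * c - b * d) ^+ 2 + (b * c + a * d) ^+ 2 =
   (b ^+ 2 + a ^+ 2) * (c ^+ 2 + d ^+ 2) by move=> *; ring.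
by rewrite cos2Dsin2 mulr1.
Qed.

Lemma pullE z i : pull z i = N%:R^-1 * \sum_j sin (z j - z i).
Proof.
rewrite /pull /mean_sin /mean_cos -!mulrA -mulrBr !mulr_suml -sumrB.
by congr (_ * _); apply: eq_bigr => j _; rewrite sinB.
Qed.

(** Action and reaction cancel; this decouples the mean phase from the interactions. *)
Lemma sum_pull z : \sum_i pull z i = 0.
Proof.
by rewrite /pull sumrB -!mulr_sumr /mean_sin /mean_cos; ring.
Qed.

(** Divided by [N R], this makes R the mean of the cosines [align z i / R], a self-consistency
    equation that determines R below. *)
Lemma sum_align z : \sum_i align z i = N%:R * order_param z ^+ 2.
Proof.
rewrite order_param_sqr /align big_split /= -!mulr_sumr.
have -> : \sum_j cos (z j) = N%:R * mean_cos z.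
  by rewrite /mean_cos mulrA divff ?mul1r // natN_neq0.
have -> : \sum_j sin (z j) = N%:R * mean_sin z.
  by rewrite /mean_sin mulrA divff ?mul1r // natN_neq0.
ring.
Qed.

Lemma normr_mean_le (F : 'I_N -> R) K : (forall j, `|F j| <= K) ->
  `|N%:R^-1 * \sum_j F j| <= K.
Proof.
move=> FK; rewrite normrM ger0_norm ?invr_ge0 ?ler0n //.
rewrite mulrC ler_pdivrMr ?natN_gt0 //.
rewrite (le_trans (ler_norm_sum _ _ _)) //.
rewrite (le_trans (ler_sum _ (fun i _ => FK i))) //.
by rewrite sumr_const card_ord mulr_natr.
Qed.

Lemma pull_le_order z i : `|pull z i| <= order_param z.
Proof.
rewrite -(ler_sqr _ _) ?nnegrE ?order_param_ge0 ?normr_ge0 //.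
by rewrite -normrX ger0_norm ?sqr_ge0 // -(pull_align z i) lerDl sqr_ge0.
Qed.

Lemma align_le_order z i : `|align z i| <= order_param z.
Proof.
rewrite -(ler_sqr _ _) ?nnegrE ?order_param_ge0 ?normr_ge0 //.
by rewrite -normrX ger0_norm ?sqr_ge0 // -(pull_align z i) lerDr sqr_ge0.
Qed.

(** [R^2] is the mean of the [align z i], each at most R; hence [R^2 <= R]. *)
Lemma order_param_le1 z : order_param z <= 1.
Proof.
have : order_param z ^+ 2 <= order_param z.
  have -> : order_param z ^+ 2 = N%:R^-1 * \sum_i align z i.
    by rewrite sum_align mulrA mulVf ?mul1r // natN_neq0.
  by rewrite (le_trans (ler_norm _)) // normr_mean_le // => i; exact: align_le_order.
by have := order_param_ge0 z; nra.
Qed.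

Lemma pull_le1 z i : `|pull z i| <= 1.
Proof. exact: le_trans (pull_le_order z i) (order_param_le1 z). Qed.

Lemma align_le1 z i : `|align z i| <= 1.
Proof. exact: le_trans (align_le_order z i) (order_param_le1 z). Qed.

(** The sine of [(phi - z j) - (phi - z i)], expanded and multiplied by [R^2], which removes any
    reference to the mean phase [phi]. *)
Lemma order_sqr_sin z i j : order_param z ^+ 2 * sin (z i - z j) =
  pull z j * align z i - align z j * pull z i.
Proof. by rewrite order_param_sqr sinB /pull /align; ring. Qed.

Lemma order_sqr_cos z i j : order_param z ^+ 2 * cos (z i - z j) =
  pull z j * pull z i + align z j * align z i.
Proof. by rewrite order_param_sqr cosB /pull /align; ring. Qed.

Lemma pull_lipschitz z w d i : (forall j, `|z j - w j| <= d) ->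
  `|pull z i - pull w i| <= 2 * d.
Proof.
move=> zw; rewrite !pullE -mulrBr -sumrB normr_mean_le // => j.
rewrite (le_trans (sin_lipschitz _ _)) //.
have -> : z j - z i - (w j - w i) = (z j - w j) - (z i - w i) by ring.
by rewrite (le_trans (ler_normB _ _)) // mulr2n mulrDl !mul1r lerD.
Qed.

Lemma order_param_sqr_lipschitz z w d : (forall j, `|z j - w j| <= d) ->
  `|order_param z ^+ 2 - order_param w ^+ 2| <= 4 * d.
Proof.
move=> zw.
have mc : `|mean_cos z - mean_cos w| <= d.
  rewrite /mean_cos -mulrBr -sumrB normr_mean_le // => j.
  exact: le_trans (cos_lipschitz _ _) (zw j).
have ms : `|mean_sin z - mean_sin w| <= d.
  rewrite /mean_sin -mulrBr -sumrB normr_mean_le // => j.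
  exact: le_trans (sin_lipschitz _ _) (zw j).
have mc1 v : `|mean_cos v| <= 1 by rewrite normr_mean_le // => j; exact: cos_max.
have ms1 v : `|mean_sin v| <= 1 by rewrite normr_mean_le // => j; exact: sin_max.
have aux (a b : R) : `|a - b| <= d -> `|a| <= 1 -> `|b| <= 1 ->
    `|a ^+ 2 - b ^+ 2| <= 2 * d.
  move=> abd a1 b1; rewrite subr_sqr normrM mulrC ler_pM //.
  by rewrite (le_trans (ler_normD _ _)) //; lra.
have := aux _ _ mc (mc1 z) (mc1 w); have := aux _ _ ms (ms1 z) (ms1 w).
rewrite !order_param_sqr => b a.
rewrite (_ : _ - _ = (mean_cos z ^+ 2 - mean_cos w ^+ 2) +
  (mean_sin z ^+ 2 - mean_sin w ^+ 2)); last by ring.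
by rewrite (le_trans (ler_normD _ _)) //; lra.
Qed.

Lemma order_param_addc z a : order_param (fun i => z i + a) = order_param z.
Proof.
rewrite !order_paramE; congr Num.sqrt; rewrite /mean_cos /mean_sin.
under eq_bigr do rewrite cosD.
under [X in _ + (_ * X) ^+ 2]eq_bigr do rewrite sinD.
rewrite sumrB big_split /= -!mulr_suml.
set A := \sum_j cos (z j); set B := \sum_j sin (z j).
have -> : forall u c s : R, (u * (A * c - B * s)) ^+ 2 + (u * (B * c + A * s)) ^+ 2 =
   ((u * A) ^+ 2 + (u * B) ^+ 2) * (c ^+ 2 + s ^+ 2) by move=> *; ring.
by rewrite cos2Dsin2 mulr1.
Qed.

Lemma pull_addc z a i : pull (fun i => z i + a) i = pull z i.
Proof.
rewrite !pullE; congr (_ * _); apply: eq_bigr => j _; congr sin.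
by rewrite opprD addrACA subrr addr0.
Qed.

Lemma align_over_order_sqr z i : 0 < order_param z ->
  (align z i / order_param z) ^+ 2 = 1 - (pull z i / order_param z) ^+ 2.
Proof.
move=> o0; have E : align z i ^+ 2 = order_param z ^+ 2 - pull z i ^+ 2.
  by have := pull_align z i; lra.
by rewrite !expr_div_n E; field; rewrite gt_eqF.
Qed.

Definition n_opposite z := #|[pred i | align z i < 0]|.

(** * Configurations with weak pulls *)

Section NearLocked.
Variables (r s : R).
Hypothesis r01 : 0 < r <= 1.
Hypothesis s_small : 0 <= s <= r ^+ 2 / 4.

Let r_gt0 : 0 < r. Proof. by case/andP: r01. Qed.

Lemma near_locked_order_gt0 z : near_locked s r z -> 0 < order_param z.
Proof. by case=> _; exact: lt_le_trans. Qed.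

Lemma near_locked_cos_sqr z i : near_locked s r z ->
  1 - s ^+ 2 / r ^+ 2 <= (align z i / order_param z) ^+ 2 <= 1.
Proof.
move=> zP; have o0 := near_locked_order_gt0 zP.
case: zP => /(_ i) zs ro.
rewrite align_over_order_sqr // expr_div_n lerD2l lerN2 gerBl divr_ge0 ?sqr_ge0 // andbT.
rewrite ler_pM ?sqr_ge0 ?invr_ge0 ?sqr_ge0 //.
  rewrite -(ger0_norm (sqr_ge0 (pull z i))) normrX ler_sqr ?nnegrE //.
  exact: le_trans zs.
rewrite lef_pV2 ?posrE ?exprn_gt0 // ler_sqr ?nnegrE // ltW //.
Qed.

Lemma s_over_r : s / r <= r / 4.
Proof.
case/andP: s_small => _ sr; rewrite ler_pdivrMr //; apply: le_trans sr _.
by rewrite expr2 mulrAC.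
Qed.

Lemma s_over_r_sqr : s ^+ 2 / r ^+ 2 <= 16^-1.
Proof.
rewrite -expr_div_n; have sr := s_over_r; case/andP: r01 => _ r1.
have s0 : 0 <= s / r by rewrite divr_ge0 ?(ltW r_gt0) //; case/andP: s_small.
by rewrite (_ : 16^-1 = (4^-1) ^+ 2 :> R); [rewrite ler_sqr ?nnegrE //; lra|field].
Qed.

(** As [s / r <= 1 / 4], the squared cosine is at least [15 / 16]; being aligned or opposite is thus
    unambiguous. *)
Lemma near_locked_cos_ge z i : near_locked s r z ->
  1 / 2 <= `|align z i / order_param z|.
Proof.
move=> /near_locked_cos_sqr - /(_ i) /andP[+ _].
have := s_over_r_sqr.
rewrite -[in X in _ -> X -> _](ger0_norm (sqr_ge0 (align z i / _))) normrX.
by have := normr_ge0 (align z i / order_param z); nra.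
Qed.

Lemma near_locked_align_neq0 z i : near_locked s r z -> align z i != 0.
Proof.
move=> /near_locked_cos_ge - /(_ i); apply: contraTneq => ->.
by rewrite mul0r normr0 -ltNge; lra.
Qed.

Lemma near_locked_align_lt0 z i : near_locked s r z -> align z i < 0 ->
  align z i <= - (r / 2).
Proof.
move=> zP az; have o0 := near_locked_order_gt0 zP.
have := near_locked_cos_ge i zP; rewrite ltr0_norm; last first.
  by rewrite ltr_pdivrMr // mul0r.
rewrite -mulNr ler_pdivlMr //; case: zP => _ ro; lra.
Qed.

(** R is the mean of the cosines [align z i / R], each close to [1] or [-1]; the opposite
    oscillators supply the [-1]. *)
Lemma order_param_quantized z : near_locked s r z ->
  `|order_param z - (1 - 2 * (n_opposite z)%:R / N%:R)| <= s ^+ 2 / r ^+ 2.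
Proof.
move=> zP; have o0 := near_locked_order_gt0 zP.
have -> : order_param z = N%:R^-1 * \sum_i (align z i / order_param z).
  rewrite -mulr_suml sum_align; field; rewrite gt_eqF //=; exact: natN_neq0.
have -> : 1 - 2 * (n_opposite z)%:R / N%:R =
    N%:R^-1 * \sum_i (if align z i < 0 then -1 else 1) :> R.
  rewrite (eq_bigr (fun i => 1 - (if align z i < 0 then 2 else 0))); last first.
    by move=> i _; case: ifP => _; rewrite ?subr0 //; lra.
  rewrite sumrB sumr_const card_ord -big_mkcond sumr_const.
  rewrite -[2 *+ _]mulr_natr /n_opposite.
  by field; exact: natN_neq0.
rewrite -mulrBr -sumrB normr_mean_le // => i.
have /andP[lo hi] := near_locked_cos_sqr i zP.
set c := align z i / order_param z in lo hi *.
(* As [|c| <= 1], the error is [1 - |c| <= 1 - c ^+ 2]. *)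
case: ifP => az.
  have c0 : c < 0 by rewrite ltr_pdivrMr // mul0r.
  by rewrite opprK ger0_norm; nra.
have c0 : 0 <= c by rewrite divr_ge0 ?(ltW o0) // leNgt az.
by rewrite ler0_norm; nra.
Qed.

(** With the signs of the cosines fixed, R is the mean of [+- sqrt (1 - (pull z i / R)^2)]. This
    fixed-point equation depends on R with Lipschitz constant [1 / 8], so R and then the cosines are
    Lipschitz in the pulls. *)
Lemma near_locked_contraction z w d : near_locked s r z -> near_locked s r w ->
  (forall i, (0 < align z i) = (0 < align w i)) ->
  (forall i, `|pull z i - pull w i| <= d) ->
  `|order_param z - order_param w| <= d /\
  forall i, `|align z i / order_param z - align w i / order_param w| <= d.
Proof.
move=> zP wP sgn dP.
have oz := near_locked_order_gt0 zP; have ow := near_locked_order_gt0 wP.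
set D := `|order_param z - order_param w|.
have D0 : 0 <= D by exact: normr_ge0.
(* By Pythagoras [|a - b| |a + b| = |p - q| |p + q|]. Equal signs give [|a + b| >= 1], and small
   sines give [|p + q| <= r / 2], which cancels the [1 / r] due to the division of the pulls by
   R. *)
have step i : `|align z i / order_param z - align w i / order_param w| <=
    d / 2 + D / 8.
  have cz := near_locked_cos_ge i zP; have cw := near_locked_cos_ge i wP.
  have := align_over_order_sqr i oz; have := align_over_order_sqr i ow; move: cz cw.
  have sgnc : (0 < align z i / order_param z) = (0 < align w i / order_param w).
    by rewrite !pmulr_lgt0 ?invr_gt0.
  have su v : near_locked s r v -> `|pull v i / order_param v| <= r / 4.
    move=> vP; apply: le_trans s_over_r.
    have ov := near_locked_order_gt0 vP; case: vP => /(_ i) vs ro.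
    rewrite normrM ler_pM // gtr0_norm ?invr_gt0 //.
    by rewrite lef_pV2 ?posrE.
  have dd : `|pull z i / order_param z - pull w i / order_param w| <=
      (d + D / 4) / r.
    rewrite (_ : _ - _ = ((pull z i - pull w i) +
       (pull w i / order_param w) * (order_param w - order_param z)) / order_param z);
      last by field; rewrite !gt_eqF.
    rewrite normrM ler_pM //; last first.
      by rewrite gtr0_norm ?invr_gt0 // lef_pV2 ?posrE //; case: zP.
    rewrite (le_trans (ler_normD _ _)) // lerD //.
    rewrite normrM distrC -/D mulrC ler_wpM2l // (le_trans (su w wP)) //.
    by case/andP: r01 => _; lra.
  move: (su z zP) (su w wP) dd sgnc.
  set a := align z i / _; set b := align w i / _.
  set p := pull z i / _; set q := pull w i / _.
  move=> pr qr pq ab a2 b2 Eb Ea.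
  have abq : (a - b) * (a + b) = - ((p - q) * (p + q)).
    by have := f_equal2 (fun x y => x - y) Ea Eb; nra.
  have ab1 : 1 <= `|a + b|.
    move: ab a2 b2; case: (ltP 0 b) => b0 ab.
      by rewrite !gtr0_norm ?addr_gt0 //; lra.
    have {}ab : a <= 0 by rewrite leNgt ab.
    by rewrite !ler0_norm //; lra.
  have : `|a - b| <= `|p - q| * `|p + q|.
    have := congr1 Num.norm abq; rewrite normrN !normrM => <-.
    by rewrite ler_peMr.
  move/le_trans; apply.
  have pq2 : `|p + q| <= r / 2 by rewrite (le_trans (ler_normD _ _)) //; lra.
  have dD : 0 <= (d + D / 4) / r := le_trans (normr_ge0 _) pq.
  apply: (@le_trans _ _ ((d + D / 4) / r * (r / 2))); first exact: ler_pM.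
  have -> : (d + D / 4) / r * (r / 2) = d / 2 + D / 8 by field; exact: lt0r_neq0.
  exact: lexx.
(* The contraction: the term in [D] on the right is absorbed on the left. *)
have Dd : D <= d / 2 + D / 8.
  rewrite {1}/D.
  have mE v : 0 < order_param v ->
      order_param v = N%:R^-1 * \sum_i (align v i / order_param v).
    move=> ov; rewrite -mulr_suml sum_align; field; rewrite gt_eqF //=.
    exact: natN_neq0.
  by rewrite {1}(mE z oz) {1}(mE w ow) -mulrBr -sumrB normr_mean_le.
by split; [|move=> i; apply: le_trans (step i) _]; lra.
Qed.

End NearLocked.

End Configurations.

(** * Energy of the centered flow *)

(* The inertial model in the time scale kappa t and in the frame of the mean
   phase: mu = m kappa, and p i is the centered natural frequency over kappa. *)
Record centered_flow (R : realType) (N : nat) (eta mu : R) (p : 'I_N -> R)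
    (x v w : 'I_N -> R -> R) : Prop := CenteredFlow {
  flow_mu_gt0 : 0 < mu;
  flow_mu_le : mu <= eta;
  flow_p : forall i, `|p i| <= eta;
  flow_v0 : forall i, `|v i 0| <= 1;
  flow_dx : forall i (t : R), 0 <= t -> is_derive t 1 (x i) (v i t);
  flow_dv : forall i (t : R), 0 <= t -> is_derive t 1 (v i) (w i t);
  flow_ode : forall i (t : R), 0 <= t ->
    mu * w i t + v i t = p i + pull (x^~ t) i;
  flow_centered : forall t : R, 0 <= t -> \sum_i x i t = 0
}.

Lemma centered_flow_le (R : realType) (N : nat) (eta eta' mu : R)
    (p : 'I_N -> R) (x v w : 'I_N -> R -> R) : eta <= eta' ->
  centered_flow eta mu p x v w -> centered_flow eta' mu p x v w.
Proof.
move=> ee [m0 me pe v0 dx dv ode ctr]; split=> // [|i].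
  exact: le_trans ee.
exact: le_trans (pe i) ee.
Qed.

Section Flow.
Context (R : realType) (N : nat).
Implicit Types (t u y a e h : R) (i j : 'I_N).
Hypothesis N_gt0 : (0 < N)%N.
Variables (eta mu : R) (p : 'I_N -> R) (x v w : 'I_N -> R -> R).
Hypothesis eta_le1 : eta <= 1.
Hypothesis F : centered_flow eta mu p x v w.

Let mu_gt0 : 0 < mu := flow_mu_gt0 F.
Let NR_gt0 : 0 < N%:R :> R := natN_gt0 R N_gt0.

(* At |v| = 2 the force |p + pull| <= 2 cannot increase |v|. *)
Lemma velocity_le2 i t : 0 <= t -> `|v i t| <= 2.
Proof.
move=> t0; have bound (b : R) : `|b| = 1 -> b * v i t <= 2.
  move=> b1; have force u : b * (p i + pull (x^~ u) i) <= 2.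
    rewrite (le_trans (ler_norm _)) // normrM b1 mul1r.
    rewrite (le_trans (ler_normD _ _)) //.
    have := flow_p F i; have := pull_le1 N_gt0 (x^~ u) i; have := eta_le1.
    by lra.
  have bv0 : b * v i 0 <= 1.
    by rewrite (le_trans (ler_norm _)) // normrM b1 mul1r (flow_v0 F).
  have wE u : 0 <= u -> w i u = mu^-1 * (p i + pull (x^~ u) i - v i u).
    by move=> /(flow_ode F i) <-; rewrite addrK mulrA mulVf ?mul1r // gt_eqF.
  (* The integrating factor absorbs the damping: what remains of the derivative is
     [(2 - b (p + pull)) / mu] times the factor, which is nonnegative. *)
  have : expR (mu^-1 * 0) * (2 + - (b * v i 0)) <=
      expR (mu^-1 * t) * (2 + - (b * v i t)).
    apply: (@derive_ge0_le _ (fun s => expR (mu^-1 * s) * (2 + - (b * v i s)))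
      (fun u => mu^-1 * expR (mu^-1 * u) * (2 + - (b * v i u)) +
        expR (mu^-1 * u) * (0 + - (b * w i u))) 0 t t0) => u /andP[u0 _].
      exact: (is_derive_mul (is_derive_expRc u mu^-1)
        (is_derive_add (is_derive_cstE u 2)
          (is_derive_opp (is_derive_mulc b (flow_dv F i u0))))).
    have -> : mu^-1 * expR (mu^-1 * u) * (2 + - (b * v i u)) +
        expR (mu^-1 * u) * (0 + - (b * w i u)) =
        mu^-1 * expR (mu^-1 * u) * (2 - b * (p i + pull (x^~ u) i)).
      by rewrite (wE u u0); ring.
    by rewrite !mulr_ge0 ?invr_ge0 ?(ltW mu_gt0) ?expR_ge0 // subr_ge0.
  rewrite mulr0 expR0 mul1r => H.
  have : 0 <= expR (mu^-1 * t) * (2 + - (b * v i t)).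
    by apply: le_trans H; lra.
  by rewrite pmulr_rge0 ?expR_gt0 // subr_ge0.
rewrite ler_norml; have := bound 1; have := bound (-1).
rewrite normrN normr1 mul1r mulN1r => /(_ erefl) ? /(_ erefl) ->.
by rewrite andbT lerNl.
Qed.

Lemma position_lipschitz i t u : 0 <= t -> t <= u ->
  `|x i u - x i t| <= 2 * (u - t).
Proof.
move=> t0 tu; apply: (@derive_bounded_lipschitz _ (x i) (v i) t u) => //.
  by move=> y /andP[ty _]; apply: (flow_dx F); exact: (le_trans t0 ty).
by move=> y /andP[ty _]; apply: velocity_le2; exact: (le_trans t0 ty).
Qed.

Lemma pull_time_lipschitz i t u : 0 <= t -> t <= u ->
  `|pull (x^~ u) i - pull (x^~ t) i| <= 4 * (u - t).
Proof.
move=> t0 tu; have -> : 4 * (u - t) = 2 * (2 * (u - t)) by ring.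
by apply: pull_lipschitz => // j; exact: position_lipschitz.
Qed.

Lemma mean_cos_derive t : 0 <= t -> is_derive t 1 (fun s => mean_cos (x^~ s))
  (N%:R^-1 * \sum_j - (v j t * sin (x j t))).
Proof.
move=> t0; apply: is_derive_mulc; apply: is_derive_sumE => j.
by apply: is_derive_cosf; exact: (flow_dx F).
Qed.

Lemma mean_sin_derive t : 0 <= t -> is_derive t 1 (fun s => mean_sin (x^~ s))
  (N%:R^-1 * \sum_j v j t * cos (x j t)).
Proof.
move=> t0; apply: is_derive_mulc; apply: is_derive_sumE => j.
by apply: is_derive_sinf; exact: (flow_dx F).
Qed.

Lemma align_continuous i t : 0 <= t ->
  {for t, continuous (fun s => align (x^~ s) i)}.
Proof.
move=> t0; have xi := flow_dx F i t0.
exact: (is_derive_continuous (is_derive_add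
  (is_derive_mul (mean_cos_derive t0) (is_derive_cosf xi))
  (is_derive_mul (mean_sin_derive t0) (is_derive_sinf xi)))).
Qed.

Definition order_energy t : R :=
  N%:R / 2 * order_param (x^~ t) ^+ 2 - mu / 2 * \sum_i v i t ^+ 2.

(** The linear term removes the frequencies from the energy balance; in exchange, an upper bound now
    needs a bound on the positions. *)
Definition tilted_energy t : R := order_energy t + \sum_i p i * x i t.

(** The pull on [i] is the derivative of [N R^2 / 2] in [x i]. The energy therefore changes at rate
    [sum v_i (pull_i + p_i - mu w_i)], and the equation of motion turns the bracket into [v_i]. *)
Lemma tilted_energy_derive t : 0 <= t ->
  is_derive t 1 tilted_energy (\sum_i v i t ^+ 2).
Proof.
move=> t0.
have -> : tilted_energy = (fun s =>
   (N%:R / 2 * (mean_cos (x^~ s) * mean_cos (x^~ s) +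
                mean_sin (x^~ s) * mean_sin (x^~ s))
    + - (mu / 2 * \sum_i v i s * v i s)) + \sum_i p i * x i s).
  by apply/funext => s; rewrite /tilted_energy /order_energy order_param_sqr.
have H := is_derive_add (is_derive_add
  (is_derive_mulc (N%:R / 2) (is_derive_add
    (is_derive_mul (mean_cos_derive t0) (mean_cos_derive t0))
    (is_derive_mul (mean_sin_derive t0) (mean_sin_derive t0))))
  (is_derive_opp (is_derive_mulc (mu / 2) (is_derive_sumE
    (fun i => is_derive_mul (flow_dv F i t0) (flow_dv F i t0))))))
  (is_derive_sumE (fun i => is_derive_mulc (p i) (flow_dx F i t0))).
apply: (is_derive_eq H).
set X := mean_cos (x^~ t); set Y := mean_sin (x^~ t).
have -> : \sum_i v i t ^+ 2 =
    \sum_i v i t * (p i + (Y * cos (x i t) - X * sin (x i t)) - mu * w i t).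
  apply: eq_bigr => i _; have := flow_ode F i t0; rewrite /pull -/X -/Y => <-.
  by ring.
rewrite [RHS](eq_bigr (fun i => p i * v i t +
  Y * (v i t * cos (x i t)) + X * (- (v i t * sin (x i t)))
   + - (mu / 2) * (w i t * v i t + v i t * w i t))); last by move=> i _; field.
rewrite !big_split /= -!mulr_sumr big_split /=.
set A := \sum_i - _; set B := \sum_i _ * cos _.
by field; rewrite gt_eqF.
Qed.

Lemma tilted_energy_nondecreasing t u : 0 <= t -> t <= u ->
  tilted_energy t <= tilted_energy u.
Proof.
move=> t0 tu; apply: (@derive_ge0_le _ _ (fun y => \sum_i v i y ^+ 2)) => //.
  by move=> y /andP[ty _]; apply: tilted_energy_derive; exact: (le_trans t0 ty).
by move=> y _; rewrite sumr_ge0 // => i _; exact: sqr_ge0.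
Qed.

Lemma order_energy_le_order t :
  order_energy t <= N%:R / 2 * order_param (x^~ t) ^+ 2.
Proof.
rewrite gerBl mulr_ge0 ?divr_ge0 ?(ltW mu_gt0) //.
by rewrite sumr_ge0 // => i _; exact: sqr_ge0.
Qed.

Lemma order_energy_le t : order_energy t <= N%:R / 2.
Proof.
rewrite (le_trans (order_energy_le_order t)) // ler_piMr ?divr_ge0 ?ler0n //.
by rewrite expr_le1 ?order_param_ge0 ?order_param_le1.
Qed.

Lemma order_energy_ge t : 0 <= t ->
  N%:R / 2 * order_param (x^~ t) ^+ 2 - 2 * eta * N%:R <= order_energy t.
Proof.
move=> t0; rewrite /order_energy lerD2l lerN2.
have : \sum_i v i t ^+ 2 <= \sum_(i < N) (2 ^+ 2 : R).
  apply: ler_sum => i _; rewrite -(ger0_norm (sqr_ge0 (v i t))) normrX.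
  by rewrite ler_sqr ?nnegrE // velocity_le2.
rewrite sumr_const card_ord -[_ *+ N]mulr_natr => V.
apply: (@le_trans _ _ (mu / 2 * (2 ^+ 2 * N%:R))).
  by rewrite ler_wpM2l // divr_ge0 // ltW.
rewrite (_ : _ * _ = 2 * mu * N%:R); last by field.
by rewrite ler_pM2r // ler_pM2l //; exact: flow_mu_le F.
Qed.

Lemma tilt_le t u K : (forall i, `|x i u - x i t| <= K) ->
  \sum_i p i * x i u - \sum_i p i * x i t <= N%:R * eta * K.
Proof.
move=> xK; rewrite -sumrB.
have -> : N%:R * eta * K = \sum_(i < N) eta * K.
  by rewrite sumr_const card_ord -mulrA mulr_natl.
apply: ler_sum => i _; rewrite -mulrBr (le_trans (ler_norm _)) //.
by rewrite normrM ler_pM // (flow_p F).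
Qed.

(** The tilted energy never falls, so [W] loses at most what the tilt gains. Measuring the loss by
    displacement and not by elapsed time makes it uniform over arbitrarily long locked windows. *)
Lemma order_energy_loss t u K : 0 <= t -> t <= u ->
  (forall i, `|x i u - x i t| <= K) ->
  order_energy t - N%:R * eta * K <= order_energy u.
Proof.
move=> t0 tu /tilt_le H.
by have := tilted_energy_nondecreasing t0 tu; rewrite /tilted_energy; lra.
Qed.

(* v^2 >= 2 l v - l^2, integrated over [t, t + h] with l = a / h. *)
Lemma tilted_energy_gain j t h a : 0 <= t -> 0 < h -> 0 <= a ->
  a <= `|x j (t + h) - x j t| -> a ^+ 2 / h <= tilted_energy (t + h) - tilted_energy t.
Proof.
move=> t0 h0 a0 ax.
have tth : t <= t + h by rewrite lerDl ltW.
have gain e : e ^+ 2 = 1 -> a <= e * (x j (t + h) - x j t) ->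
    a ^+ 2 / h <= tilted_energy (t + h) - tilted_energy t.
  move=> e2 ae; pose l := a / h.
  have : tilted_energy t - 2 * l * e * x j t + l ^+ 2 * t <=
      tilted_energy (t + h) - 2 * l * e * x j (t + h) + l ^+ 2 * (t + h).
    apply: (@derive_ge0_le _ (fun s => tilted_energy s + - (2 * l * e * x j s) + l ^+ 2 * s)
      (fun s => \sum_i v i s ^+ 2 + - (2 * l * e * v j s) + l ^+ 2 * 1) _ _ tth).
      move=> y /andP[ty _]; have y0 := le_trans t0 ty.
      exact: (is_derive_add (is_derive_add (tilted_energy_derive y0)
        (is_derive_opp (is_derive_mulc _ (flow_dx F j y0))))
        (is_derive_mulc _ (is_derive_idE y))).
    move=> y _; rewrite (bigD1 j) //=.
    have : 0 <= \sum_(i | i != j) v i y ^+ 2 by rewrite sumr_ge0 // => i _; exact: sqr_ge0.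
    have := sqr_ge0 (e * v j y - l).
    have -> : (e * v j y - l) ^+ 2 = e ^+ 2 * v j y ^+ 2 - 2 * l * e * v j y + l ^+ 2 by ring.
    by rewrite e2; lra.
  have l0 : 0 <= l by rewrite divr_ge0 // ltW.
  have -> : a ^+ 2 / h = 2 * l * a - l ^+ 2 * h by rewrite /l; field; rewrite gt_eqF.
  by have := ler_wpM2l (mulr_ge0 (ler0n _ 2) l0) ae; lra.
case: (leP 0 (x j (t + h) - x j t)) ax => d0 ax.
  by apply: (gain 1); rewrite ?expr1n // mul1r -[leRHS]ger0_norm.
by apply: (gain (-1)); rewrite ?sqrrN ?expr1n // mulN1r -[leRHS]ler0_norm // ltW.
Qed.

(** * Strong pulls, weak pulls and the energy budget *)

Section Thresholds.
Variables (r h : R).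
Hypothesis r01 : 0 < r <= 1.
Hypothesis h_small : 0 < h <= r ^+ 2 / 128.
Hypothesis eta_small : eta * N%:R <= h ^+ 3 / 8.

Let r_gt0 : 0 < r. Proof. by case/andP: r01. Qed.
Let h_gt0 : 0 < h. Proof. by case/andP: h_small. Qed.
Let h_le : h <= 128^-1.
Proof.
case/andP: r01 => _ r1; case/andP: h_small => _; move/le_trans; apply.
by rewrite ler_piMl // expr_le1 // ltW.
Qed.
Let eta_ge0 : 0 <= eta := le_trans (ltW mu_gt0) (flow_mu_le F).
Let eta_le_h3 : eta <= h ^+ 3 / 8.
Proof. by rewrite (le_trans _ eta_small) // ler_peMr // ler1n. Qed.

(** During a time [h], [x j + mu v j] moves in one direction at speed at least
    [8 h - 4 h - 2 h = 2 h]. Of the distance [2 h^2], at most [h^2] is due to [mu v j]; so [x j]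
    moves by [h^2], which yields [(h^2)^2 / h = h^3]. *)
Lemma strong_pull_gain j t : 0 <= t -> 8 * h <= `|pull (x^~ t) j| ->
  order_energy t + h ^+ 3 - N%:R * eta * (2 * h) <= order_energy (t + h).
Proof.
move=> t0 St.
have h3 : h ^+ 3 <= h ^+ 2.
  by rewrite exprS ler_piMl ?sqr_ge0 //; have := h_le; lra.
have h2 : h ^+ 2 <= h.
  by rewrite expr2 ler_piMl ?ltW //; have := h_le; lra.
have tth : t <= t + h by rewrite lerDl ltW.
have moved : h ^+ 2 <= `|x j (t + h) - x j t|.
  have E y : 0 <= y -> is_derive y 1 (fun u => x j u + mu * v j u)
      (p j + pull (x^~ y) j).
    move=> y0; rewrite -(flow_ode F j y0) addrC.
    exact: is_derive_add (flow_dx F j y0) (is_derive_mulc mu (flow_dv F j y0)).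
  have vb : `|mu * v j (t + h) - mu * v j t| <= h ^+ 2.
    rewrite -mulrBr normrM gtr0_norm //.
    have v4 : `|v j (t + h) - v j t| <= 4.
      rewrite (le_trans (ler_normB _ _)) // (_ : 4 = 2 + 2 :> R); last by ring.
      by rewrite lerD // velocity_le2 // (le_trans t0).
    have m1 : mu <= h ^+ 2 / 4.
      by have := le_trans (flow_mu_le F) eta_le_h3; have := sqr_ge0 h; lra.
    apply: (@le_trans _ _ (h ^+ 2 / 4 * 4)); last by lra.
    by rewrite ler_pM // ltW.
  have P y : t <= y <= t + h -> `|pull (x^~ y) j - pull (x^~ t) j| <= 4 * h.
    move=> /andP[ty yth]; rewrite (le_trans (pull_time_lipschitz j t0 ty)) //.
    by lra.
  have pe : `|p j| <= 2 * h.
    by have := le_trans (flow_p F j) eta_le_h3; have := h_gt0; lra.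
  have psi e : e ^+ 2 = 1 -> 8 * h <= e * pull (x^~ t) j ->
      h ^+ 2 <= `|x j (t + h) - x j t|.
    move=> e2 eS; have e1 : `|e| = 1.
      by apply/eqP; rewrite -(@eqrXn2 _ 2) // -normrX e2 normr1 expr1n.
    have := @derive_ge_ler _ (fun u => e * (x j u + mu * v j u))
      (fun y => e * (p j + pull (x^~ y) j)) t (t + h) (2 * h) tth.
    have -> : 2 * h * (t + h - t) = 2 * h ^+ 2 by ring.
    move=> /(_ (fun y ty => is_derive_mulc e (E y (le_trans t0 (proj1 (andP ty)))))) H.
    have {H} : 2 * h ^+ 2 <=
        e * (x j (t + h) + mu * v j (t + h)) - e * (x j t + mu * v j t).
      apply: H => y /P Py.
      have a : `|e * (pull (x^~ y) j - pull (x^~ t) j)| <= 4 * h by rewrite normrM e1 mul1r.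
      have b : `|e * p j| <= 2 * h by rewrite normrM e1 mul1r.
      by move: a b; rewrite !ler_norml => /andP[? _] /andP[? _]; lra.
    have a : `|e * (mu * v j (t + h) - mu * v j t)| <= h ^+ 2.
      by rewrite normrM e1 mul1r.
    have b : e * (x j (t + h) - x j t) <= `|x j (t + h) - x j t|.
      by rewrite (le_trans (ler_norm _)) // normrM e1 mul1r.
    move: a; rewrite ler_norml => /andP[_ a]; lra.
  case: (leP 0 (pull (x^~ t) j)) St => S0 St.
    by apply: (psi 1); rewrite ?expr1n // mul1r -[leRHS]ger0_norm.
  by apply: (psi (-1)); rewrite ?sqrrN ?expr1n // mulN1r -[leRHS]ler0_norm // ltW.
have := tilted_energy_gain t0 h_gt0 (sqr_ge0 h) moved.
have -> : (h ^+ 2) ^+ 2 / h = h ^+ 3 by field; rewrite gt_eqF.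
have xK i : `|x i (t + h) - x i t| <= 2 * h.
  by rewrite (le_trans (position_lipschitz i t0 tth)) //; lra.
by have := tilt_le xK; rewrite /tilted_energy; lra.
Qed.

(** By [order_sqr_sin] the sine is at most [32 h / R], and [32 h <= r / 4]. *)
Lemma near_locked_sin i j t : near_locked (16 * h) r (x^~ t) ->
  `|sin (x i t - x j t)| <= 4^-1.
Proof.
move=> zP; have o0 := near_locked_order_gt0 r01 zP.
have := order_sqr_sin (x^~ t) i j => /(congr1 Num.norm).
rewrite normrM (ger0_norm (sqr_ge0 _)) => E.
case: zP => Ss ro.
have sr : 2 * (16 * h) <= r / 4.
  by case/andP: h_small => _; case/andP: r01 => _; have := r_gt0; nra.
have : `|pull (x^~ t) j * align (x^~ t) i - align (x^~ t) j * pull (x^~ t) i| <=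
    2 * (16 * h) * order_param (x^~ t).
  rewrite (le_trans (ler_normB _ _)) // !normrM.
  have := ler_pM (normr_ge0 _) (normr_ge0 _) (Ss j) (align_le_order (x^~ t) i).
  have := ler_pM (normr_ge0 _) (normr_ge0 _) (align_le_order (x^~ t) j) (Ss i).
  by lra.
rewrite -E (mulrC _ (order_param _)) expr2 -mulrA ler_pM2l // => H.
by rewrite -(ler_pM2l o0) (le_trans H) // (le_trans sr) // ler_pM2r.
Qed.

(** All phase differences stay near multiples of pi, so by continuity none can move by [pi / 2 < 2].
    Since the positions sum to 0, [x i] is the mean of its differences to the others. The bound does
    not depend on [u - t]. *)
Lemma near_locked_displacement t u : 0 <= t -> t <= u ->
  (forall y, t <= y <= u -> near_locked (16 * h) r (x^~ y)) ->
  forall i, `|x i u - x i t| <= 2.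
Proof.
move=> t0 tu P i.
have pair j : `|(x i u - x j u) - (x i t - x j t)| <= 2.
  apply: ltW; apply: lt_trans (pihalf_lt2 R).
  apply: (@sin_confinement _ (fun y => x i y - x j y) t u) => //.
  - by have := pi_gt0 R; lra.
  - move=> y /andP[ty _]; have y0 := le_trans t0 ty.
    exact: is_derive_continuous
      (is_derive_add (flow_dx F i y0) (is_derive_opp (flow_dx F j y0))).
  - move=> y tyu; rewrite sin_pihalf sinB.
    have a := near_locked_sin i j (P _ tyu).
    have b := near_locked_sin i j (P t (_ : t <= t <= u)).
    rewrite lexx tu in b; have {}b := b isT.
    rewrite (le_lt_trans (ler_normB _ _)) // !normrM.
    have := ler_pM (normr_ge0 _) (normr_ge0 _) a (cos_max (x i t - x j t)).
    have := ler_pM (normr_ge0 _) (normr_ge0 _) (cos_max (x i y - x j y)) b.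
    by lra.
have -> : x i u - x i t = N%:R^-1 * \sum_j ((x i u - x j u) - (x i t - x j t)).
  rewrite !sumrB !sumr_const card_ord !(flow_centered F) // ?(le_trans t0) //.
  by rewrite !subr0 -[x i u *+ N]mulr_natl -[x i t *+ N]mulr_natl -mulrBr mulKf // natN_neq0.
exact: normr_mean_le.
Qed.

(** Either some pull exceeds [8 h] at [t] and [W] gains, or all pulls stay below [8 h + 4 h] until
    [t + h]. The gain [h^3] minus losses of at most [h^3 / 8] and [h^3 / 4] leaves [h^3 / 2]. The
    alternative [t0 = t] starts the induction, when no locked window precedes. *)
Lemma stage_step t0 t : 0 <= t0 -> t0 <= t ->
  N%:R * r ^+ 2 <= order_energy t0 ->
  (t0 = t \/ forall y, t0 <= y <= t -> near_locked (16 * h) r (x^~ y)) ->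
  order_energy t0 + h ^+ 3 / 2 <= order_energy (t + h) \/
  forall y, t <= y <= t + h -> near_locked (16 * h) r (x^~ y).
Proof.
move=> t00 t0t W0 P; have t_ge0 := le_trans t00 t0t.
have Wt : order_energy t0 - N%:R * eta * 2 <= order_energy t.
  case: P => [->|P]; last exact/order_energy_loss/near_locked_displacement.
  by rewrite gerBl !mulr_ge0 // ler0n.
have etaN : N%:R * eta <= h ^+ 3 / 8 by rewrite mulrC.
have [[j /ltW Sj]|Ss] := pselect (exists j, 8 * h < `|pull (x^~ t) j|).
  left; have := strong_pull_gain t_ge0 Sj.
  have : N%:R * eta * (2 * h) <= h ^+ 3 / 8.
    rewrite (le_trans _ etaN) // ler_piMr ?mulr_ge0 ?ler0n //.
    by have := h_le; lra.
  by have := exprn_gt0 3 h_gt0; lra.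
right=> y /andP[ty yt]; split.
  move=> i; have := pull_time_lipschitz i t_ge0 ty.
  have : `|pull (x^~ t) i| <= 8 * h.
    by rewrite leNgt; apply/negP => H; apply: Ss; exists i.
  have := ler_normD (pull (x^~ y) i - pull (x^~ t) i) (pull (x^~ t) i).
  by rewrite subrK; lra.
have Wy : order_energy t - N%:R * eta * 2 <= order_energy y.
  apply: order_energy_loss => // i.
  by rewrite (le_trans (position_lipschitz i t_ge0 ty)) //; have := h_le; lra.
(* The losses up to [y] total at most [h^3 / 2 <= r^2 / 2], so [N R^2 / 2 >= W] still gives
   [R >= r]. *)
have h3 : h ^+ 3 <= r ^+ 2.
  case/andP: h_small => _ sr; have := sqr_ge0 r; have := h_le; have := h_gt0.
  have -> : h ^+ 3 = h * h * h by ring.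
  move=> ? ? ?; have : h * h <= 1 by nra.
  by nra.
have := order_energy_le_order y => Wo.
have N1 : 1 <= N%:R :> R by rewrite ler1n.
have r2 := sqr_ge0 r.
have : r ^+ 2 <= order_param (x^~ y) ^+ 2.
  rewrite -(ler_pM2l NR_gt0).
  have : r ^+ 2 <= N%:R * r ^+ 2 by rewrite ler_peMl.
  by lra.
by rewrite ler_sqr ?nnegrE ?order_param_ge0 // ltW.
Qed.

(* Sampling at the times t0 + k h avoids exit times: the pull is
   Lipschitz, so it is controlled between the samples. *)
Lemma stage t0 n : 0 <= t0 -> N%:R * r ^+ 2 <= order_energy t0 ->
  (forall y, t0 <= y <= t0 + n.+1%:R * h -> near_locked (16 * h) r (x^~ y)) \/
  exists2 t1, t0 <= t1 <= t0 + n.+1%:R * h &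
    order_energy t0 + h ^+ 3 / 2 <= order_energy t1.
Proof.
move=> t00 W0; have h0 := h_gt0.
elim: n => [|n [IH|[t1 /andP[t01 t1n] W1]]].
- rewrite mul1r; have [gain|P] := stage_step t00 (lexx t0) W0 (or_introl erefl).
    by right; exists (t0 + h) => //; rewrite lexx lerDl ltW.
  by left.
- have t0t : t0 <= t0 + n.+1%:R * h by rewrite lerDl mulr_ge0 // ltW.
  have E : t0 + n.+1%:R * h + h = t0 + n.+2%:R * h.
    by rewrite -(natr1 n.+1); ring.
  have [gain|P] := stage_step t00 t0t W0 (or_intror IH).
    right; rewrite E in gain.
    by exists (t0 + n.+2%:R * h); rewrite // lexx lerDl mulr_ge0 // ltW.
  rewrite E in P; left => y /andP[t0y yt].
  case: (leP y (t0 + n.+1%:R * h)) => yn; first by apply: IH; rewrite t0y.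
  by apply: P; rewrite yt ltW.
- right; exists t1 => //; rewrite t01 (le_trans t1n) // lerD2l ler_pM2r //.
  by rewrite ler_nat.
Qed.

(** If locking failed after every candidate time, [stage] would supply gains of [h^3 / 2] for ever
    and push [W] past [N / 2]. *)
Lemma eventually_near_locked t0 : 0 <= t0 ->
  N%:R * r ^+ 2 <= order_energy t0 ->
  exists t1, [/\ t0 <= t1, order_energy t0 <= order_energy t1 &
    forall y, t1 <= y -> near_locked (16 * h) r (x^~ y)].
Proof.
move=> t00 W0; apply/not_existsP => H.
have h30 : 0 < h ^+ 3 / 2 by rewrite divr_gt0 // exprn_gt0.
have climb k : exists2 t, t0 <= t &
    order_energy t0 + k%:R * (h ^+ 3 / 2) <= order_energy t.
  elim: k => [|k [t t0t Wt]]; first by exists t0; rewrite // mul0r addr0.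
  have Wt0 : order_energy t0 <= order_energy t.
    by apply: le_trans Wt; rewrite lerDl mulr_ge0 // ltW.
  have [y ty nP] : exists2 y, t <= y & ~ near_locked (16 * h) r (x^~ y).
    apply/not_exists2P => Q; apply: (H t); split=> // y ty.
    by apply: contrapT => Py; have [] := Q y.
  have [n yn] : exists n, y <= t + n.+1%:R * h.
    exists (Num.truncn ((y - t) / h)).
    by rewrite -lerBlDl -ler_pdivrMr // ltW // truncnS_gt.
  have [P|[t1 /andP[tt1 _] W1]] :=
      stage n (le_trans t00 t0t) (le_trans W0 Wt0).
    by case: nP; apply: P; rewrite ty.
  exists t1; first exact: le_trans tt1.
  by rewrite -natr1 mulrDl mul1r addrA (le_trans _ W1) // lerD2r.
have [t t0t] := climb (Num.truncn ((N%:R / 2 - order_energy t0) / (h ^+ 3 / 2))).+1.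
have := order_energy_le t.
have : N%:R / 2 - order_energy t0 <
  (Num.truncn ((N%:R / 2 - order_energy t0) / (h ^+ 3 / 2))).+1%:R * (h ^+ 3 / 2).
  by rewrite -ltr_pdivrMr // truncnS_gt.
by lra.
Qed.

End Thresholds.
End Flow.

(** * Asymptotics near locked states *)

Lemma cauchy_at_infty_family (R : realType) (n : nat) (f : 'I_n -> R -> R)
    (e t0 : R) : 0 < e -> (forall i, cauchy_at_infty (f i)) ->
  exists2 T, Num.max 0 t0 <= T &
    forall i t u, T <= t -> T <= u -> `|f i t - f i u| <= e.
Proof.
move=> e0 fC; have /choice[T TP] i : exists T, forall t u, T <= t -> T <= u ->
    `|f i t - f i u| <= e by have [T _ fT] := fC i _ e0; exists T.
exists (\big[Num.max/Num.max 0 t0]_i T i); first exact: bigmax_ge_id.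
move=> i t u Tt Tu; apply: TP; first by apply: le_trans Tt; exact: le_bigmax.
by apply: le_trans Tu; exact: le_bigmax.
Qed.

Section Asymptotics.
Context (R : realType) (N : nat).
Implicit Types (t u y a e : R) (i j : 'I_N).
Hypothesis N_gt0 : (0 < N)%N.
Variables (eta mu : R) (p : 'I_N -> R) (x v w : 'I_N -> R -> R).
Hypothesis eta_le1 : eta <= 1.
Hypothesis F : centered_flow eta mu p x v w.
Variables (r h : R).
Hypothesis r01 : 0 < r <= 1.
Hypothesis h_small : 0 < h <= r ^+ 2 / 128.
Variable t1 : R.
Hypothesis t1_ge0 : 0 <= t1.
Hypothesis locked : forall t, t1 <= t -> near_locked (16 * h) r (x^~ t).

Let mu_gt0 : 0 < mu := flow_mu_gt0 F.
Let s_small : 0 <= 16 * h <= r ^+ 2 / 4.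
Proof.
by case/andP: h_small => h0 hr; have := sqr_ge0 r => r2; apply/andP; split; lra.
Qed.

Lemma acceleration_le i t : 0 <= t -> `|w i t| <= 4 / mu.
Proof.
move=> t0; rewrite ler_pdivlMr // mulrC -[X in X * _]ger0_norm ?(ltW mu_gt0) //.
rewrite -normrM.
have -> : mu * w i t = p i + pull (x^~ t) i - v i t.
  by rewrite -(flow_ode F i t0) addrK.
have := flow_p F i; have := pull_le1 N_gt0 (x^~ t) i; have := eta_le1.
have := velocity_le2 N_gt0 eta_le1 F i t0.
rewrite !ler_norml => /andP[? ?] ? /andP[? ?] /andP[? ?].
by apply/andP; split; lra.
Qed.

Lemma velocity_lipschitz i t u : 0 <= t -> t <= u ->
  `|v i u - v i t| <= 4 / mu * (u - t).
Proof.
move=> t0 tu; apply: (@derive_bounded_lipschitz _ (v i) (w i) t u) => //.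
  by move=> y /andP[ty _]; apply: (flow_dv F); exact: (le_trans t0 ty).
by move=> y /andP[ty _]; apply: acceleration_le; exact: (le_trans t0 ty).
Qed.

Lemma displacement_le2 i t : t1 <= t -> `|x i t - x i t1| <= 2.
Proof.
move=> t1t; apply: (near_locked_displacement N_gt0 F r01 h_small t1_ge0 t1t).
by move=> y /andP[ty _]; exact: locked.
Qed.

Lemma order_energy_locked t : t1 <= t ->
  order_energy mu x v t1 - N%:R * eta * 2 <= N%:R / 2 * order_param (x^~ t) ^+ 2.
Proof.
move=> t1t; have xK i := displacement_le2 i t1t.
rewrite (le_trans (order_energy_loss N_gt0 F t1_ge0 t1t xK)) //.
exact: (order_energy_le_order F).
Qed.

(** The tilted energy is nondecreasing and, as displacements stay below 2, bounded. Barbalat's lemma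
    applies to its derivative [sum v_i^2], which is Lipschitz because velocities and accelerations
    are bounded. *)
Lemma velocity_cvg0 i : v i t @[t --> +oo] --> (0 : R).
Proof.
have EC : cauchy_at_infty (tilted_energy mu p x v).
  apply: (@nondecreasing_bounded_cauchy _ _ t1
    (N%:R / 2 + \sum_j p j * x j t1 + N%:R * eta * 2) t1_ge0).
    move=> t u t1t tu; apply: (tilted_energy_nondecreasing N_gt0 F) => //.
    exact: le_trans t1t.
  move=> t t1t; have := order_energy_le N_gt0 F t.
  have := tilt_le F (fun j => displacement_le2 j t1t).
  by rewrite /tilted_energy; lra.
have K0 : 0 < N%:R * (16 / mu) by rewrite !mulr_gt0 ?ltr0n ?invr_gt0.
have v2 := @cauchy_lipschitz_derivative _ _ (fun t => \sum_j v j t ^+ 2) t1 _ K0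
  t1_ge0 (fun t t1t => tilted_energy_derive N_gt0 F (le_trans t1_ge0 t1t)) _ EC.
have {}v2 : \sum_j v j t ^+ 2 @[t --> +oo] --> (0 : R).
  apply: v2 => t u t1t tu; have t0 := le_trans t1_ge0 t1t.
  rewrite -sumrB (le_trans (ler_norm_sum _ _ _)) //.
  have -> : N%:R * (16 / mu) * (u - t) = \sum_(j < N) 16 / mu * (u - t).
    by rewrite sumr_const card_ord -mulrA mulr_natl.
  apply: ler_sum => j _; rewrite subr_sqr normrM.
  have -> : 16 / mu * (u - t) = 4 / mu * (u - t) * 4 by ring.
  rewrite ler_pM // ?velocity_lipschitz //.
  rewrite (le_trans (ler_normD _ _)) // (_ : 4 = 2 + 2 :> R); last by ring.
  by rewrite lerD // (velocity_le2 N_gt0 eta_le1 F) // (le_trans t0).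
apply: le_cvg_at_infty => e e0.
have [T T0 vT] := cvg_at_infty_le v2 (exprn_gt0 2 e0).
exists T => // t /vT; rewrite !subr0 => vt.
rewrite -ler_sqr ?nnegrE ?(ltW e0) // -normrX ger0_norm ?sqr_ge0 //.
apply: le_trans vt; apply: le_trans (ler_norm _).
by rewrite (bigD1 i) //= lerDl sumr_ge0 // => j _; exact: sqr_ge0.
Qed.

(** The velocities converge and, by the equation of motion, the accelerations are Lipschitz;
    Barbalat's lemma makes the latter vanish, and the equation leaves [p i + pull -> 0]. *)
Lemma pull_cvg i : pull (x^~ t) i @[t --> +oo] --> - p i.
Proof.
have K0 : 0 < mu^-1 * (4 + 4 / mu).
  by rewrite mulr_gt0 ?addr_gt0 ?divr_gt0 ?invr_gt0.
have wE t : 0 <= t -> w i t = mu^-1 * (p i + pull (x^~ t) i - v i t).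
  by move=> /(flow_ode F i) <-; rewrite addrK mulrA mulVf ?mul1r // gt_eqF.
have w0 : w i t @[t --> +oo] --> (0 : R).
  apply: (@cauchy_lipschitz_derivative _ (v i) _ 0 _ K0) => //.
  - by move=> t t0; exact: (flow_dv F).
  - move=> t u t0 tu; rewrite !wE // ?(le_trans t0) // -mulrBr normrM.
    rewrite gtr0_norm ?invr_gt0 // -mulrA ler_pM2l ?invr_gt0 //.
    have -> : p i + pull (x^~ u) i - v i u - (p i + pull (x^~ t) i - v i t) =
      (pull (x^~ u) i - pull (x^~ t) i) - (v i u - v i t) by ring.
    rewrite (le_trans (ler_normB _ _)) // mulrDl lerD //.
      exact: (pull_time_lipschitz N_gt0 eta_le1 F).
    exact: velocity_lipschitz.
  - exact: cvg_cauchy_at_infty (@velocity_cvg0 i).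
have H : mu * w i t + v i t - p i @[t --> +oo] --> mu * 0 + 0 - p i.
  apply: cvgB; last exact: cvg_cst.
  by apply: cvgD; [apply: cvgM => //; exact: cvg_cst|exact: (@velocity_cvg0 i)].
rewrite mulr0 !add0r in H; apply: (@eq_cvg_at_infty _ _ _ _ 0 _ H) => t t0.
by rewrite (flow_ode F) // addrC addKr.
Qed.

Lemma align_sign_constant i t u : t1 <= t -> t <= u ->
  (0 < align (x^~ t) i) = (0 < align (x^~ u) i).
Proof.
move=> t1t tu; apply: (@continuous_neq0_pos _ (fun y => align (x^~ y) i) t u tu).
  move=> y /andP[ty _]; apply: (align_continuous F).
  exact: (le_trans t1_ge0 (le_trans t1t ty)).
move=> y /andP[ty _]; apply: (near_locked_align_neq0 r01 s_small).
exact: locked (le_trans t1t ty).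
Qed.

(** The signs of [align] are frozen, so [near_locked_contraction] compares the states at two times
    and passes the Cauchy property from the pulls to R and the cosines. *)
Lemma locked_cauchy e : 0 < e -> exists2 T, Num.max 0 t1 <= T &
  forall t u, T <= t -> T <= u ->
    `|order_param (x^~ t) - order_param (x^~ u)| <= e /\
    forall i, `|align (x^~ t) i / order_param (x^~ t) -
                align (x^~ u) i / order_param (x^~ u)| <= e.
Proof.
move=> e0.
have [T t1T PT] := @cauchy_at_infty_family _ _ (fun i t => pull (x^~ t) i) e t1 e0
  (fun i => cvg_cauchy_at_infty (@pull_cvg i)).
exists T => // t u Tt Tu; move: t1T; rewrite ge_max => /andP[_ t1T].
have t1t := le_trans t1T Tt; have t1u := le_trans t1T Tu.
apply: (near_locked_contraction N_gt0 r01 s_small (locked t1t) (locked t1u)).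
  move=> i; case: (leP t u) => [tu|/ltW ut]; first exact: align_sign_constant.
  by apply/esym; exact: align_sign_constant.
by move=> i; exact: PT.
Qed.

Lemma order_param_cvg : exists l, order_param (x^~ t) @[t --> +oo] --> (l : R).
Proof.
apply: cauchy_at_infty_cvg => e /locked_cauchy[T]; rewrite ge_max => /andP[T0 _] PT.
by exists T => // t u Tt Tu; have [] := PT _ _ Tt Tu.
Qed.

Lemma order_limit_ge l : order_param (x^~ t) @[t --> +oo] --> (l : R) -> r <= l.
Proof.
move=> ol; rewrite leNgt; apply/negP => lr.
have rl : 0 < (r - l) / 2 by rewrite divr_gt0 // subr_gt0.
have [T T0 /(_ (Num.max T t1))] := cvg_at_infty_le ol rl.
rewrite le_max lexx => /(_ isT); rewrite ler_norml => /andP[_].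
have /locked[_] : t1 <= Num.max T t1 by rewrite le_max lexx orbT.
by lra.
Qed.

(** [k] counts the opposite oscillators at a late time. Half of the error is the quantization error
    there, half the distance from R to its limit. *)
Lemma order_limit_quantized l :
  order_param (x^~ t) @[t --> +oo] --> (l : R) ->
  exists k : nat, `|l - (1 - 2 * k%:R / N%:R)| <= 2 * ((16 * h) ^+ 2 / r ^+ 2).
Proof.
move=> ol; have h0 : 0 < 16 * h by rewrite mulr_gt0 //; case/andP: h_small.
have r0 : 0 < r by case/andP: r01.
have e0 : 0 < (16 * h) ^+ 2 / r ^+ 2 by rewrite divr_gt0 // exprn_gt0.
have [T T0 /(_ (Num.max T t1))] := cvg_at_infty_le ol e0.
rewrite le_max lexx => /(_ isT) lT.
have /locked zP : t1 <= Num.max T t1 by rewrite le_max lexx orbT.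
have := order_param_quantized N_gt0 r01 zP.
set k := n_opposite _ => lk; exists k.
rewrite distrC in lT; have := ler_normD (l - order_param (x^~ (Num.max T t1)))
  (order_param (x^~ (Num.max T t1)) - (1 - 2 * k%:R / N%:R)).
by rewrite addrA subrK; lra.
Qed.

Lemma order_limit_energy l :
  order_param (x^~ t) @[t --> +oo] --> (l : R) ->
  order_energy mu x v t1 - N%:R * eta * 2 <= N%:R / 2 * l ^+ 2.
Proof.
move=> ol.
have H : N%:R / 2 * order_param (x^~ t) ^+ 2 @[t --> +oo] --> N%:R / 2 * l ^+ 2.
  apply: cvgM; first exact: cvg_cst.
  by rewrite expr2; under eq_cvg do rewrite expr2; exact: cvgM.
rewrite leNgt; apply/negP => lt.
have d0 := lt; rewrite -subr_gt0 in d0.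
have [T T0 /(_ (Num.max T t1))] := cvg_at_infty_le H (divr_gt0 d0 (ltr0n _ 2)).
rewrite le_max lexx => /(_ isT); rewrite ler_norml => /andP[_].
have /order_energy_locked : t1 <= Num.max T t1 by rewrite le_max lexx orbT.
by lra.
Qed.

(** Divided by [R^2], [order_sqr_sin] and [order_sqr_cos] express both through pulls and aligns over
    R, all of which converge since the limit of R is at least [r > 0]. *)
Lemma sin_cos_difference_cvg i j :
  (exists l, sin (x i t - x j t) @[t --> +oo] --> (l : R)) /\
  (exists l, cos (x i t - x j t) @[t --> +oo] --> (l : R)).
Proof.
have [l lP] := order_param_cvg.
have l_neq0 : l != 0.
  by rewrite gt_eqF // (lt_le_trans _ (order_limit_ge lP)) //; case/andP: r01.
have cC k : cauchy_at_infty (fun t => align (x^~ t) k / order_param (x^~ t)).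
  move=> e /locked_cauchy[T]; rewrite ge_max => /andP[T0 _] PT.
  by exists T => // t u Tt Tu; have [] := PT _ _ Tt Tu.
have [ci ciP] := cauchy_at_infty_cvg (cC i).
have [cj cjP] := cauchy_at_infty_cvg (cC j).
have sC k : pull (x^~ t) k / order_param (x^~ t) @[t --> +oo] --> - p k / l.
  by apply: cvgM; [exact: (@pull_cvg k)|exact: cvgV].
have o_gt0 t : t1 <= t -> order_param (x^~ t) != 0.
  by move=> t1t; rewrite gt_eqF // (near_locked_order_gt0 r01 (locked t1t)).
split.
- exists (- p j / l * ci - cj * (- p i / l)).
  have H : pull (x^~ t) j / order_param (x^~ t) *
      (align (x^~ t) i / order_param (x^~ t)) -
      align (x^~ t) j / order_param (x^~ t) *
      (pull (x^~ t) i / order_param (x^~ t)) @[t --> +oo] -->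
      - p j / l * ci - cj * (- p i / l).
    by apply: cvgB; apply: cvgM => //; exact: (@sC _).
  apply: (@eq_cvg_at_infty _ _ _ _ t1 _ H) => t /o_gt0 o_neq0.
  have /(canRL (mulKf _)) -> := order_sqr_sin (x^~ t) i j; last by rewrite expf_neq0.
  by field.
- exists (- p j / l * (- p i / l) + cj * ci).
  have H : pull (x^~ t) j / order_param (x^~ t) *
      (pull (x^~ t) i / order_param (x^~ t)) +
      align (x^~ t) j / order_param (x^~ t) *
      (align (x^~ t) i / order_param (x^~ t)) @[t --> +oo] -->
      - p j / l * (- p i / l) + cj * ci.
    by apply: cvgD; apply: cvgM => //; exact: (@sC _).
  apply: (@eq_cvg_at_infty _ _ _ _ t1 _ H) => t /o_gt0 o_neq0.
  have /(canRL (mulKf _)) -> := order_sqr_cos (x^~ t) i j; last by rewrite expf_neq0.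
  by field.
Qed.

(** Sine and cosine determine the difference only modulo 2 pi; continuity, through
    [sin_confinement], excludes further turns. *)
Lemma difference_cauchy i j : cauchy_at_infty (fun t => x i t - x j t).
Proof.
move=> e e0.
pose e1 := Num.min e 1; have e1P : 0 < e1 <= 1.
  by rewrite lt_min e0 ltr01 ge_min lexx orbT.
case/andP: e1P => e10 e11.
have e1pi : 0 < e1 < pi.
  by rewrite e10 (le_lt_trans e11) // (lt_le_trans _ (pi_ge2 R)) // ltr1n.
have sin0 := sin_gt0_pi e1pi.
have [[ls lsP] [lc lcP]] := sin_cos_difference_cvg i j.
have [T1 T10 sT] := cvg_cauchy_at_infty lsP (divr_gt0 sin0 (ltr0n _ 4)).
have [T2 T20 cT] := cvg_cauchy_at_infty lcP (divr_gt0 sin0 (ltr0n _ 4)).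
exists (Num.max T1 T2); first by rewrite le_max T10.
move=> t u; wlog tu : t u / t <= u.
  move=> H Tt Tu; case: (leP t u) => [|/ltW] tu; first exact: H.
  by rewrite distrC; exact: H.
rewrite !ge_max => /andP[T1t T2t] _.
rewrite distrC; apply: (@le_trans _ _ e1); last by rewrite ge_min lexx.
have t0 := le_trans T10 T1t; apply: ltW.
apply: (@sin_confinement _ (fun y => x i y - x j y) t u) => //.
  move=> y /andP[ty _]; have y0 := le_trans t0 ty.
  exact: is_derive_continuous
      (is_derive_add (flow_dx F i y0) (is_derive_opp (flow_dx F j y0))).
move=> y /andP[ty _]; rewrite sinB.
have a := sT _ _ (le_trans T1t ty) T1t; have b := cT _ _ (le_trans T2t ty) T2t.
set A := x i y - x j y in a b *; set B := x i t - x j t in a b *.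
have -> : sin A * cos B - cos A * sin B =
  (sin A - sin B) * cos B - (cos A - cos B) * sin B by ring.
rewrite (le_lt_trans (ler_normB _ _)) // !normrM.
have := ler_pM (normr_ge0 _) (normr_ge0 _) a (cos_max B).
have := ler_pM (normr_ge0 _) (normr_ge0 _) b (sin_max B).
by lra.
Qed.

Lemma position_cvg i : exists l, x i t @[t --> +oo] --> (l : R).
Proof.
apply: cauchy_at_infty_cvg => e e0.
have [T] := cauchy_at_infty_family 0 e0 (difference_cauchy i).
rewrite maxxx => T0 PT; exists T => // t u Tt Tu.
have -> : x i t - x i u = N%:R^-1 * \sum_j ((x i t - x j t) - (x i u - x j u)).
  rewrite !sumrB !sumr_const card_ord !(flow_centered F) ?(le_trans T0) //.
  by rewrite !subr0 -[x i u *+ N]mulr_natl -[x i t *+ N]mulr_natl -mulrBr mulKf // natN_neq0.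
by apply: normr_mean_le => // j; exact: PT.
Qed.

End Asymptotics.

(** * Separation of distinct phases *)

Section PhaseDifferences.
Context (R : realType) (N : nat).
Implicit Types (t u y : R) (i j : 'I_N).
Hypothesis N_gt0 : (0 < N)%N.

(* Both identities come from the half-angle form of pull and align at the
   midpoint of z i and z j. *)
Lemma pull_align_midpoint (z : 'I_N -> R) i j : exists2 a, `|a| <= 1 &
  pull z i - pull z j = - (2 * sin ((z i - z j) / 2) * a) /\
  align z i + align z j = 2 * cos ((z i - z j) / 2) * a.
Proof.
pose c := (z i + z j) / 2; pose d := (z i - z j) / 2.
exists (mean_cos z * cos c + mean_sin z * sin c).
  rewrite -(@expr_le1 _ 2) // -normrX ger0_norm ?sqr_ge0 //.
  apply: (@le_trans _ _ (order_param z ^+ 2)).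
    have := sqr_ge0 (mean_cos z * sin c - mean_sin z * cos c).
    have : order_param z ^+ 2 =
        (mean_cos z ^+ 2 + mean_sin z ^+ 2) * (cos c ^+ 2 + sin c ^+ 2).
      by rewrite cos2Dsin2 mulr1 order_param_sqr.
    by move=> ->; lra.
  by rewrite expr_le1 ?order_param_ge0 ?order_param_le1.
have zi : z i = c + d by rewrite /c /d; field.
have zj : z j = c - d by rewrite /c /d; field.
rewrite /pull /align -/d zi zj sinD cosD sinB cosB.
by split; ring.
Qed.

Section Flow.
Variables (eta mu : R) (p : 'I_N -> R) (x v w : 'I_N -> R -> R).
Hypothesis eta_le1 : eta <= 1.
Hypothesis F : centered_flow eta mu p x v w.

Let mu_gt0 : 0 < mu := flow_mu_gt0 F.
Let eta_ge0 : 0 <= eta := le_trans (ltW mu_gt0) (flow_mu_le F).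

(* The derivative of x i + mu v i is p i + pull, with no second derivative. *)
Definition shifted_gap i j t : R :=
  ((x i t + mu * v i t) - (x j t + mu * v j t)) / 2.

Definition separation i j t : R := sin (shifted_gap i j t) ^+ 2.

(** By [pull_align_midpoint] the estimated sum would vanish without inertia and frequencies. The
    frequencies contribute at most [2 eta], the shift by [mu v] at most [4 eta]. *)
Lemma separation_derive i j t : 0 <= t -> exists2 du,
  is_derive t 1 (separation i j) du &
  `|du + separation i j t * (align (x^~ t) i + align (x^~ t) j)| <= 6 * eta.
Proof.
move=> t0.
have dpsi k : is_derive t 1 (fun s => x k s + mu * v k s) (p k + pull (x^~ t) k).
  rewrite -(flow_ode F k t0) addrC.
  exact: is_derive_add (flow_dx F k t0) (is_derive_mulc mu (flow_dv F k t0)).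
have dg : is_derive t 1 (shifted_gap i j)
    (2^-1 * ((p i + pull (x^~ t) i) + - (p j + pull (x^~ t) j))).
  have := is_derive_mulc 2^-1 (is_derive_add (dpsi i) (is_derive_opp (dpsi j))).
  by under eq_fun do rewrite mulrC.
have ds := is_derive_sinf dg.
eexists; first exact: (is_derive_mul ds ds).
have [a a1 [pa aa]] := pull_align_midpoint (x^~ t) i j.
rewrite aa /separation.
set d := (x i t - x j t) / 2 in pa aa *; set g := shifted_gap i j t.
have -> : p i + pull (x^~ t) i - (p j + pull (x^~ t) j) =
    (p i - p j) - 2 * sin d * a.
  by rewrite -[X in _ - X]opprK -pa; ring.
have -> : 2^-1 * (p i - p j - 2 * sin d * a) * cos g * sin g +
  sin g * (2^-1 * (p i - p j - 2 * sin d * a) * cos g) +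
  sin g ^+ 2 * (2 * cos d * a) =
  (p i - p j) * (sin g * cos g) - 2 * (a * (sin g * sin (d - g))).
  by rewrite sinB; field.
have dge : `|sin (d - g)| <= 2 * eta.
  rewrite (le_trans (sin_abs_le _)) //.
  have -> : d - g = - (mu * (v i t - v j t) / 2).
    by rewrite /d /g /shifted_gap; field.
  rewrite normrN !normrM (gtr0_norm mu_gt0) (ger0_norm (_ : 0 <= 2^-1)) ?invr_ge0 //.
  have vv : `|v i t - v j t| <= 4.
    rewrite (le_trans (ler_normB _ _)) // (_ : 4 = 2 + 2 :> R); last by ring.
    by rewrite lerD // (velocity_le2 N_gt0 eta_le1 F).
  have := ler_pM (ltW mu_gt0) (normr_ge0 _) (flow_mu_le F) vv.
  by lra.
have pp : `|p i - p j| <= 2 * eta.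
  by have := ler_normB (p i) (p j); have := flow_p F i; have := flow_p F j; lra.
rewrite (le_trans (ler_normB _ _)) // !normrM (ger0_norm (_ : (0 : R) <= 2)) //.
have sc : `|sin g| * `|cos g| <= 1 * 1 by rewrite ler_pM // ?sin_max ?cos_max.
have h1 := ler_pM (normr_ge0 _) (mulr_ge0 (normr_ge0 _) (normr_ge0 _)) pp sc.
have h2 := ler_pM (normr_ge0 _) (normr_ge0 _) (sin_max g) dge.
have h3 := ler_pM (normr_ge0 _) (mulr_ge0 (normr_ge0 _) (normr_ge0 _)) a1 h2.
by have := eta_ge0; lra.
Qed.

(** The common integrating-factor step for decay ([a = 2]) and growth ([a = - r]). The derivative is
    known only through its estimate, hence the quantification over [du]. *)
Lemma separation_monotone i j (a b t u : R) : 0 <= t -> t <= u ->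
  (forall y du, t <= y <= u -> is_derive y 1 (separation i j) du ->
    `|du + separation i j y * (align (x^~ y) i + align (x^~ y) j)| <= 6 * eta ->
    0 <= a * (separation i j y + b) + du) ->
  expR (a * t) * (separation i j t + b) <= expR (a * u) * (separation i j u + b).
Proof.
move=> t0 tu H.
have /choice[du duP] y : exists du, 0 <= y -> is_derive y 1 (separation i j) du /\
  `|du + separation i j y * (align (x^~ y) i + align (x^~ y) j)| <= 6 * eta.
  have [y0|/negP y0] := boolP (0 <= y); last by exists 0.
  by have [d] := separation_derive i j y0; exists d.
apply: (@derive_ge0_le _ (fun y => expR (a * y) * (separation i j y + b))
  (fun y => a * expR (a * y) * (separation i j y + b) + expR (a * y) * (du y + 0)) t u tu).
  move=> y /andP[ty _]; have [dy _] := duP y (le_trans t0 ty).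
  exact: (is_derive_mul (is_derive_expRc y a) (is_derive_add dy (is_derive_cstE y b))).
move=> y tyu; have [ty _] := andP tyu; have [dy dyP] := duP y (le_trans t0 ty).
have -> : a * expR (a * y) * (separation i j y + b) + expR (a * y) * (du y + 0) =
  expR (a * y) * (a * (separation i j y + b) + du y) by ring.
by rewrite mulr_ge0 ?expR_ge0 // (H _ _ tyu dy dyP).
Qed.

Lemma separation_ge0 i j t : 0 <= separation i j t.
Proof. exact: sqr_ge0. Qed.

Lemma separation_le1 i j t : separation i j t <= 1.
Proof.
by rewrite /separation -[leLHS]ger0_norm ?sqr_ge0 // normrX expr_le1 // sin_max.
Qed.

(** Needs no locking, only [align <= 1]: distinct phases stay quantitatively apart up to any given
    time. *)
Lemma separation_decay i j t : 0 <= t ->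
  separation i j 0 <= expR (2 * t) * (separation i j t + 3 * eta).
Proof.
move=> t0.
have : expR (2 * 0) * (separation i j 0 + 3 * eta) <=
    expR (2 * t) * (separation i j t + 3 * eta).
  apply: (@separation_monotone i j 2 _ 0 t) => //.
  move=> y du _ _; rewrite ler_norml => /andP[lo _].
  have := align_le1 N_gt0 (x^~ y) i; have := align_le1 N_gt0 (x^~ y) j.
  rewrite !ler_norml => /andP[_ ?] /andP[_ ?].
  have : separation i j y * (align (x^~ y) i + align (x^~ y) j) <= separation i j y * 2.
    by rewrite ler_wpM2l ?separation_ge0 //; lra.
  by lra.
by rewrite mulr0 expR0 mul1r; apply: le_trans; rewrite lerDl mulr_ge0.
Qed.

(** Above the level [6 eta / r], where repulsion outweighs the errors, the excess grows at least
    like [expR (r (u - t)) >= 1 + r (u - t)], while the separation never exceeds 1. This bounds the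
    length of the window. *)
Lemma separation_growth i j t u (r : R) : 0 <= t -> t <= u -> 0 < r ->
  (forall y, t <= y <= u -> align (x^~ y) i + align (x^~ y) j <= - r) ->
  (1 + r * (u - t)) * (separation i j t - 6 * eta / r) <= 1 \/
  separation i j t <= 6 * eta / r.
Proof.
move=> t0 tu r0 A; case: (leP (separation i j t) (6 * eta / r)) => s; [by right|left].
have : expR (- r * t) * (separation i j t + - (6 * eta / r)) <=
    expR (- r * u) * (separation i j u + - (6 * eta / r)).
  apply: (@separation_monotone i j (- r) _ t u) => //.
  move=> y du tyu _; rewrite ler_norml => /andP[lo _].
  have : separation i j y * (align (x^~ y) i + align (x^~ y) j) <=
      separation i j y * - r by rewrite ler_wpM2l ?separation_ge0 // A.
  have -> : - r * (separation i j y + - (6 * eta / r)) =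
    - r * separation i j y + 6 * eta by field; rewrite gt_eqF.
  by lra.
have -> : - r * t = - r * u + r * (u - t) by ring.
rewrite expRD -mulrA ler_pM2l ?expR_gt0 // => H.
have : (1 + r * (u - t)) * (separation i j t - 6 * eta / r) <=
    expR (r * (u - t)) * (separation i j t - 6 * eta / r).
  by rewrite ler_wpM2r ?expR_ge1Dx // subr_ge0 ltW.
move=> /le_trans; apply; apply: le_trans H _.
have q0 : 0 <= 6 * eta / r by rewrite divr_ge0 ?mulr_ge0 // ltW.
by have := separation_le1 i j u; lra.
Qed.

Lemma separation0_ge i j (d : R) :
  d <= sin ((x i 0 - x j 0) / 2) ^+ 2 -> d - 2 * eta <= separation i j 0.
Proof.
move=> dx; rewrite /separation; set g := shifted_gap i j 0.
set e := (x i 0 - x j 0) / 2 in dx *.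
have ge : `|sin e - sin g| <= eta.
  rewrite (le_trans (sin_lipschitz _ _)) //.
  have -> : e - g = - (mu * (v i 0 - v j 0) / 2).
    by rewrite /e /g /shifted_gap; field.
  rewrite normrN !normrM (gtr0_norm mu_gt0) (ger0_norm (_ : 0 <= 2^-1)) ?invr_ge0 //.
  have vv : `|v i 0 - v j 0| <= 2.
    rewrite (le_trans (ler_normB _ _)) // (_ : 2 = 1 + 1 :> R); last by ring.
    by rewrite lerD // (flow_v0 F).
  have := ler_pM (ltW mu_gt0) (normr_ge0 _) (flow_mu_le F) vv.
  by lra.
have : `|sin e ^+ 2 - sin g ^+ 2| <= eta * 2.
  rewrite subr_sqr normrM ler_pM // (le_trans (ler_normD _ _)) //.
  by rewrite (_ : 2 = 1 + 1 :> R); [rewrite lerD ?sin_max|ring].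
by rewrite ler_norml => /andP[_]; lra.
Qed.

End Flow.
End PhaseDifferences.

(* Two oscillators opposite to the mean phase repel each other exponentially
   fast, so a locked window with two of them has a length bounded in terms of
   their separation; every other window gains energy, which happens at most k
   times. *)
Lemma reach_one_opposite (R : realType) (N : nat) (r h d : R) (k : nat) :
  (0 < N)%N -> 0 < r <= 1 -> 0 < h <= r ^+ 2 / 128 -> 0 < d ->
  forall T, 0 <= T -> exists2 eta0 : R, 0 < eta0 &
  forall (mu : R) (p : 'I_N -> R) (x v w : 'I_N -> R -> R),
  centered_flow eta0 mu p x v w ->
  (forall i j, i != j -> d <= sin ((x i 0 - x j 0) / 2) ^+ 2) ->
  forall t0, 0 <= t0 <= T -> N%:R * r ^+ 2 <= order_energy mu x v t0 ->
  N%:R / 2 < order_energy mu x v t0 + k%:R * (h ^+ 3 / 2) ->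
  exists t1, [/\ 0 <= t1, order_energy mu x v t0 <= order_energy mu x v t1,
    near_locked (16 * h) r (x^~ t1) & (n_opposite (x^~ t1) <= 1)%N].
Proof.
move=> N_gt0 r01 h_small d0.
have [/andP[r0 r1] /andP[h0 hr]] := (r01, h_small).
have N0 : 0 < N%:R :> R by rewrite ltr0n.
have s_small : 0 <= 16 * h <= r ^+ 2 / 4.
  by have := sqr_ge0 r => r2; apply/andP; split; lra.
elim: k => [|k IH] T T0.
  (* With no gain left, [W] would already exceed its maximum [N / 2]. *)
  exists 1 => // mu p x v w F _ t0 _ _.
  by rewrite mul0r addr0 ltNge (order_energy_le N_gt0 F).
(* A lower bound for every separation up to time [T], by [separation_decay] from an initial
   separation of at least [d / 2]. *)
pose u1 := expR (- (2 * T)) * d / 4.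
have u10 : 0 < u1 by apply: divr_gt0 => //; apply: mulr_gt0 => //; exact: expR_gt0.
(* A window of [n.+1] steps is longer than [2 / (u1 r)], too long for [separation_growth] with an
   excess of at least [u1 / 2]. *)
pose n := Num.truncn (2 / (u1 * r * h)).
have urh : 0 < u1 * r * h by apply: mulr_gt0 => //; exact: mulr_gt0.
have nP : 2 / u1 < r * (n.+1%:R * h).
  have : 2 / (u1 * r * h) < n.+1%:R by exact: truncnS_gt.
  rewrite ltr_pdivrMr // => H.
  by rewrite ltr_pdivrMr // (lt_le_trans H) // le_eqVlt; apply/orP; left; apply/eqP; ring.
(* After a gain the induction continues with this later time horizon. *)
have T'0 : 0 <= T + n.+1%:R * h by rewrite addr_ge0 // mulr_ge0 // ltW.
have [eta1 eta10 IH1] := IH _ T'0.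
(* The second pair serves [stage]; [d / 4] keeps the initial separations above [d / 2]; [u1 r / 12]
   gives [3 eta0 <= u1 / 4] and [6 eta0 / r <= u1 / 2]. *)
pose eta0 := Num.min eta1 (Num.min (Num.min 1 (h ^+ 3 / 8 / N%:R)) (Num.min (d / 4) (u1 * r / 12))).
have h30 : 0 < h ^+ 3 / 8 / N%:R by rewrite !divr_gt0 // exprn_gt0.
have d40 : 0 < d / 4 by rewrite divr_gt0.
have ur0 : 0 < u1 * r / 12 by apply: divr_gt0 => //; exact: mulr_gt0.
exists eta0; first by rewrite !lt_min eta10 ltr01 h30 d40.
move=> mu p x v w F sep t0 /andP[t00 t0T] W0 Wk.
have eta01 : eta0 <= eta1 by rewrite ge_min lexx.
have : eta0 <= Num.min (Num.min 1 (h ^+ 3 / 8 / N%:R)) (Num.min (d / 4) (u1 * r / 12)).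
  by rewrite ge_min lexx orbT.
rewrite !le_min => /andP[/andP[eta_le1 etaN] /andP[etad etau]].
rewrite ler_pdivlMr // in etaN.
have eta_ge0 : 0 <= eta0 := le_trans (ltW (flow_mu_gt0 F)) (flow_mu_le F).
have [P|[t1 /andP[t01 t1T] W1]] := stage N_gt0 eta_le1 F r01 h_small etaN n t00 W0.
  exists t0; split=> //.
    by apply: P; rewrite lexx lerDl mulr_ge0 // ltW.
  rewrite leqNgt; apply/negP => /card_gt1P[i [j [ai aj ij]]].
  rewrite !inE in ai aj.
  have len0 : t0 <= t0 + n.+1%:R * h by rewrite lerDl mulr_ge0 // ltW.
  have neg l : align (x^~ t0) l < 0 -> forall y, t0 <= y <= t0 + n.+1%:R * h ->
      align (x^~ y) l <= - (r / 2).
    move=> al y /andP[ty yt].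
    have yP : near_locked (16 * h) r (x^~ y) by apply: P; rewrite ty.
    apply: (near_locked_align_lt0 r01 s_small yP).
    have y_neq0 := near_locked_align_neq0 r01 s_small l yP.
    have := @continuous_neq0_pos _ (fun s => align (x^~ s) l) t0 y ty.
    rewrite ltNge (ltW al) /= => E; rewrite lt_neqAle y_neq0 /= leNgt -E //.
      by move=> s /andP[ts _]; apply: (align_continuous F); exact: le_trans ts.
    move=> s /andP[ts sy]; apply: (near_locked_align_neq0 r01 s_small).
    by apply: P; rewrite ts (le_trans sy).
  have dec := separation_decay N_gt0 eta_le1 F i j t00.
  have s0 := separation0_ge F (sep i j ij).
  have su1 : u1 <= separation mu x v i j t0.
    have : d / 2 <= expR (2 * T) * (separation mu x v i j t0 + 3 * eta0).
      apply: (@le_trans _ _ (expR (2 * t0) * (separation mu x v i j t0 + 3 * eta0))).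
        by lra.
      apply: ler_wpM2r; last by rewrite ler_expR ler_pM2l.
      by rewrite addr_ge0 ?separation_ge0 // mulr_ge0.
    rewrite -(@ler_pM2l _ (expR (- (2 * T)))) ?expR_gt0 // [leRHS]mulrA -expRD addNr expR0 mul1r => H.
    have : u1 * r / 12 <= u1 / 12 by rewrite ler_pM2r // ler_piMr // ltW.
    have E2 : expR (- (2 * T)) * (d / 2) = 2 * u1 by rewrite /u1; field.
    rewrite E2 in H.
    by move=> ?; lra.
  have e_r : 6 * eta0 / r <= u1 / 2.
    by rewrite ler_pdivrMr //; lra.
  have [|grow|] := separation_growth N_gt0 eta_le1 F t00 len0 r0 (i := i) (j := j).
  - move=> y ty; have := neg i ai y ty; have := neg j aj y ty; lra.
  - have E3 : t0 + n.+1%:R * h - t0 = n.+1%:R * h by ring.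
    rewrite E3 in grow.
    have : (2 / u1) * (u1 / 2) < (1 + r * (n.+1%:R * h)) * (separation mu x v i j t0 - 6 * eta0 / r).
      apply: (@lt_le_trans _ _ ((1 + r * (n.+1%:R * h)) * (u1 / 2))).
        have u120 : 0 < u1 / 2 by apply: divr_gt0.
        by rewrite (ltr_pM2r u120) (lt_trans nP) // ltrDr.
      rewrite ler_wpM2l ?addr_ge0 ?mulr_ge0 ?(ltW h0) ?(ltW r0) //; lra.
    have -> : 2 / u1 * (u1 / 2) = 1 by field; rewrite gt_eqF.
    by lra.
  - by lra.
have [|||t2 [t20 W2 P2 n2]] := IH1 _ _ _ _ _ (centered_flow_le eta01 F) sep t1.
- by rewrite (le_trans t00 t01) (le_trans t1T) // lerD2r.
- by rewrite (le_trans W0) // (le_trans _ W1) // lerDl divr_ge0 // exprn_ge0 // ltW.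
- by move: Wk; rewrite -(natr1 k) mulrDl mul1r; lra.
exists t2; split=> //; apply: le_trans W2; apply: le_trans W1.
by rewrite lerDl divr_ge0 // exprn_ge0 // ltW.
Qed.

(** * Locking of the centered flow *)

Lemma flow_locks (R : realType) (N : nat) (eta mu : R) (p : 'I_N -> R)
    (x v w : 'I_N -> R -> R) (r h t0 : R) :
  (0 < N)%N -> eta <= 1 -> 0 < r <= 1 -> 0 < h <= r ^+ 2 / 128 ->
  eta * N%:R <= h ^+ 3 / 8 -> centered_flow eta mu p x v w -> 0 <= t0 ->
  N%:R * r ^+ 2 <= order_energy mu x v t0 ->
  [/\ forall i, exists l, x i t @[t --> +oo] --> (l : R),
      forall i, v i t @[t --> +oo] --> (0 : R) &
      exists l : R, [/\ order_param (x^~ t) @[t --> +oo] --> l, r <= l,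
        exists k : nat, `|l - (1 - 2 * k%:R / N%:R)| <= 2 * ((16 * h) ^+ 2 / r ^+ 2) &
        order_energy mu x v t0 - N%:R * eta * 2 <= N%:R / 2 * l ^+ 2]].
Proof.
move=> N_gt0 eta_le1 r01 h_small etaN F t00 W0.
have [t1 [t01 W1 P]] := eventually_near_locked N_gt0 eta_le1 F r01 h_small etaN t00 W0.
have t10 := le_trans t00 t01.
split.
- exact: (position_cvg N_gt0 eta_le1 F r01 h_small t10 P).
- by move=> i; exact: (velocity_cvg0 N_gt0 eta_le1 F r01 h_small t10 P).
have [l lP] := order_param_cvg N_gt0 eta_le1 F r01 h_small t10 P.
exists l; split=> //.
- exact: (order_limit_ge P lP).
- exact: (order_limit_quantized N_gt0 r01 h_small P lP).
- have := order_limit_energy N_gt0 F r01 h_small t10 P lP; lra.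
Qed.

Lemma sin_intmul_pi (R : realType) (k : int) : sin (k%:~R * pi) = 0 :> R.
Proof.
have nat_case n : sin (n%:R * pi) = 0 :> R.
  rewrite mulr_natl -[_ *+ _]add0r (alternatingn (@sinDpi R)).
  by rewrite sin0 mulr0.
by case: k => n; rewrite ?NegzE ?mulrNz ?mulNr ?sinN ?nat_case ?oppr0.
Qed.

(** Reduced modulo pi, the half difference lies between 0 and pi, pi excluded, where the sine
    vanishes only at 0. *)
Lemma sin_half_eq0 (R : realType) (a b : R) :
  sin ((a - b) / 2) = 0 -> eq_mod_2pi a b.
Proof.
move=> s0; have pi0 := pi_gt0 R; set D := (a - b) / 2 in s0.
pose k := Num.floor (D / pi); pose z := D - k%:~R * pi.
have sz : sin z = 0 by rewrite /z sinB s0 sin_intmul_pi mul0r mulr0 subrr.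
have /andP[k1 k2] := floor_itv (D / pi).
rewrite ler_pdivlMr // in k1; rewrite ltr_pdivrMr // intrD mulrDl mul1r in k2.
have z0 : z = 0.
  apply/eqP; rewrite eq_le subr_ge0 k1 andbT leNgt; apply/negP => z0.
  have : 0 < sin z by apply: sin_gt0_pi; rewrite z0 /z ltrBlDl.
  by rewrite sz ltxx.
exists k; move: z0 => /eqP; rewrite subr_eq0 => /eqP Dk.
have -> : k%:~R * (2 * pi) = 2 * D by rewrite Dk; ring.
by rewrite /D; field.
Qed.

Lemma distinct_phases_separated (R : realType) (N : nat) (z : 'I_N -> R) :
  (forall i j, i != j -> ~ eq_mod_2pi (z i) (z j)) ->
  exists2 d : R, 0 < d & forall i j, i != j -> d <= sin ((z i - z j) / 2) ^+ 2.
Proof.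
move=> zd; pose f (q : 'I_N * 'I_N) := sin ((z q.1 - z q.2) / 2) ^+ 2.
exists (\big[Num.min/1]_(q : 'I_N * 'I_N | q.1 != q.2) f q).
  apply: lt_bigmin => // -[i j] /= ij; rewrite exprn_even_gt0 //=.
  by apply/eqP => s0; apply: (zd i j ij); exact: sin_half_eq0.
by move=> i j ij; exact: (@bigmin_le_cond _ _ _ _ (i, j) (fun q => q.1 != q.2) f).
Qed.

(** The rotation [c], invisible to the order parameter, accounts for the frame of the mean phase.
    Positions are prescribed only up to [eta] because the flow will be started shortly after the
    initial time. *)
Lemma centered_flow_locking (R : realType) (N : nat) (theta0 : 'I_N -> R) (eps : R) :
  (0 < N)%N -> 0 < order_param theta0 -> 0 < eps ->
  exists2 eta : R, 0 < eta &
  forall (mu c : R) (p : 'I_N -> R) (x v w : 'I_N -> R -> R),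
  centered_flow eta mu p x v w ->
  (forall i, `|x i 0 - (theta0 i + c)| <= eta) ->
  [/\ forall i, exists l, x i t @[t --> +oo] --> (l : R),
      forall i, v i t @[t --> +oo] --> (0 : R) &
      exists2 l : R, order_param (x^~ t) @[t --> +oo] --> l &
        order_param_bound theta0 eps < l].
Proof.
move=> N_gt0 R0 eps0; have N0 : 0 < N%:R :> R by rewrite ltr0n.
have N1 : 1 <= N%:R :> R by rewrite ler1n.
set R0' := order_param theta0 in R0 *.
have R01 : R0' <= 1 by exact: order_param_le1.
(* At the start [W] is about [N R0'^2 / 2 = 2 N r^2], twice the level required for locking. *)
pose r := R0' / 2; pose e := Num.min eps 1.
(* 16 h / r = r e / 8 keeps the quantization error of R below r e / 32. *)
pose h := r ^+ 2 * e / 128.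
have r0 : 0 < r by rewrite /r; lra.
have r1 : r <= 1 / 2 by rewrite /r; lra.
have r01 : 0 < r <= 1 by apply/andP; split; lra.
have e0 : 0 < e by rewrite lt_min eps0 ltr01.
have e1 : e <= 1 by rewrite ge_min lexx orbT.
have eeps : e <= eps by rewrite ge_min lexx.
have h0 : 0 < h by rewrite /h !mulr_gt0 ?invr_gt0 ?exprn_gt0.
have h_small : 0 < h <= r ^+ 2 / 128.
  by rewrite h0 /h ler_pM2r ?invr_gt0 // ler_piMr ?sqr_ge0.
have q_small : 2 * ((16 * h) ^+ 2 / r ^+ 2) <= r * e / 32.
  have -> : (16 * h) ^+ 2 / r ^+ 2 = r * e * (r * e) / 64 by rewrite /h; field; rewrite gt_eqF.
  have re : r * e <= 1 by rewrite mulr_ile1 // ltW //; lra.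
  have re0 : 0 < r * e by rewrite mulr_gt0.
  have : r * e * (r * e) <= r * e by rewrite ger_pMr.
  by lra.
have re_r : r * e <= r by rewrite ler_piMr // ltW.
have re_e : r * e <= e by rewrite ler_piMl ?(ltW e0) //; lra.
have h30 : 0 < h ^+ 3 / 8 / N%:R by rewrite !divr_gt0 // exprn_gt0.
have re0 : 0 < r * e by rewrite mulr_gt0.
have r20 : 0 < r ^+ 2 by rewrite exprn_gt0.
(* [h^3 / 8 / N] keeps the tilt below the gains, [r e / 32] serves the comparison of order
   parameters, and [r^2 / 4] keeps the initial energy above [N r^2]. *)
pose eta1 := Num.min (Num.min 1 (h ^+ 3 / 8 / N%:R)) (Num.min (r * e / 32) (r ^+ 2 / 4)).
have eta10 : 0 < eta1.
  by rewrite !lt_min ltr01 h30; apply/andP; split; lra.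
have eta1_use eta : eta <= eta1 -> [/\ eta <= 1, eta * N%:R <= h ^+ 3 / 8,
    eta <= r * e / 32 & eta <= r ^+ 2 / 4].
  by rewrite !le_min => /andP[/andP[? H] /andP[? ?]]; split=> //; rewrite -ler_pdivlMr.
have init eta mu c p x v w : eta <= eta1 -> centered_flow eta mu p x v w ->
    (forall i, `|x i 0 - (theta0 i + c)| <= eta) ->
    N%:R / 2 * R0' ^+ 2 - 4 * eta * N%:R <= order_energy mu x v 0 /\
    N%:R * r ^+ 2 <= order_energy mu x v 0.
  move=> /eta1_use[eta_le1 _ _ etar] F x0.
  have := order_energy_ge N_gt0 eta_le1 F (lexx 0).
  have := order_param_sqr_lipschitz N_gt0 x0; rewrite order_param_addc -/R0'.
  rewrite ler_norml => /andP[lo _] W.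
  have H : N%:R / 2 * R0' ^+ 2 - 4 * eta * N%:R <= order_energy mu x v 0.
    apply: le_trans W.
    have : N%:R / 2 * - (4 * eta) <=
      N%:R / 2 * (order_param (x^~ 0) ^+ 2 - R0' ^+ 2) by rewrite ler_pM2l ?divr_gt0.
    by lra.
  split=> //; apply: le_trans H.
  have -> : R0' ^+ 2 = 4 * r ^+ 2 by rewrite /r; field.
  have : eta * N%:R <= r ^+ 2 / 4 * N%:R by rewrite ler_pM2r.
  by lra.
(* Energies compare squares of order parameters; the common lower bound [r] turns this into a
   comparison of values. *)
have sqr_gap (l b c : R) : r <= b -> r <= l -> b ^+ 2 - c <= l ^+ 2 -> c < r * e / 2 ->
    b - e / 2 < l.
  move=> rb rl bl cr; rewrite ltNge; apply/negP => lb.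
  have : e / 2 * r <= (b - l) * (b + l) by apply: ler_pM; lra.
  by rewrite -subr_sqr; lra.
(* The separation argument is run only for distinct phases with [N > 3]; for smaller [N] the
   quantized limit and its positivity suffice. *)
have [/andP[/asboolP dist N23]|general] :=
    boolP (`[< forall i j, i != j -> ~ eq_mod_2pi (theta0 i) (theta0 j) >] && (3 < N)%N).
- have [d d0 dP] := distinct_phases_separated dist.
  (* [W] starts nonnegative and is at most [N / 2], so [k] gains of [h^3 / 2] are impossible. *)
  pose k := (Num.truncn (N%:R / h ^+ 3)).+1.
  have d20 : 0 < d / 2 by rewrite divr_gt0.
  have [eta2 eta20 reach] := reach_one_opposite k N_gt0 r01 h_small d20 (lexx 0).
  exists (Num.min eta1 (Num.min eta2 (d / 4))).
    by rewrite lt_min eta10 lt_min eta20 divr_gt0.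
  set eta := Num.min _ _ => mu c p x v w F x0.
  have etaA : eta <= eta1 by rewrite ge_min lexx.
  have : eta <= Num.min eta2 (d / 4) by rewrite ge_min lexx orbT.
  rewrite le_min => /andP[etaB etaC].
  have [eta_le1 etaN etare _] := eta1_use _ etaA.
  have [_ Wr] := init _ _ _ _ _ _ _ etaA F x0.
  have sep i j : i != j -> d / 2 <= sin ((x i 0 - x j 0) / 2) ^+ 2.
    move=> /dP dij; set g := (x i 0 - x j 0) / 2; set f := (theta0 i - theta0 j) / 2 in dij.
    have fg : `|sin f - sin g| <= eta.
      rewrite (le_trans (sin_lipschitz _ _)) //.
      have -> : f - g = ((x j 0 - (theta0 j + c)) - (x i 0 - (theta0 i + c))) / 2.
        by rewrite /f /g; field.
      rewrite normrM (ger0_norm (_ : 0 <= 2^-1)) ?invr_ge0 //.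
      have := ler_normB (x j 0 - (theta0 j + c)) (x i 0 - (theta0 i + c)).
      by have := x0 i; have := x0 j; lra.
    have : `|sin f ^+ 2 - sin g ^+ 2| <= eta * 2.
      rewrite subr_sqr normrM ler_pM // (le_trans (ler_normD _ _)) //.
      by rewrite (_ : 2 = 1 + 1 :> R); [rewrite lerD ?sin_max|ring].
    by rewrite ler_norml => /andP[_]; lra.
  have W0 : 0 <= order_energy mu x v 0 by rewrite (le_trans _ Wr) // mulr_ge0 // ltW.
  have Wk : N%:R / 2 < order_energy mu x v 0 + k%:R * (h ^+ 3 / 2).
    have : N%:R < k%:R * h ^+ 3 by rewrite -ltr_pdivrMr ?exprn_gt0 // truncnS_gt.
    by lra.
  have z00 : (0 : R) <= (0 : R) <= (0 : R) by rewrite lexx.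
  have [t1 [t10 W1 P1 n1]] := reach _ _ _ _ _ (centered_flow_le etaB F) sep 0 z00 Wr Wk.
  have [xl vl [l [lP rl _ Wl]]] := flow_locks N_gt0 eta_le1 r01 h_small etaN F t10
    (le_trans Wr W1).
  split=> //; exists l => //.
  have W2 := order_energy_ge N_gt0 eta_le1 F t10.
  have := order_param_quantized N_gt0 r01 P1.
  set b := order_param (x^~ t1) in W2 *; set n := n_opposite _ in n1 *.
  rewrite ler_norml => /andP[bq _].
  have rb : r <= b by case: P1.
  (* The kinetic term at [t1] and the later loss cost [2 eta N] each; the sum is divided by
     [N / 2]. *)
  have bl : b ^+ 2 - 8 * eta <= l ^+ 2.
    have N20 : 0 < N%:R / 2 :> R by rewrite divr_gt0.
    by rewrite -(ler_pM2l N20); lra.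
  have := sqr_gap l b (8 * eta) rb rl bl; have -> : 8 * eta < r * e / 2 by lra.
  move=> /(_ isT).
  have nN : 2 * n%:R / N%:R <= 2 / N%:R :> R.
    by rewrite ler_pM2r ?invr_gt0 // ler_piMr // lern1.
  rewrite /order_param_bound (gtn_eqF (ltnW N23)) (gtn_eqF N23) /=.
  case: asboolP => // _.
  by lra.
exists eta1 => // mu c p x v w F x0.
have [eta_le1 etaN etare _] := eta1_use _ (lexx _).
have [W0 Wr] := init _ _ _ _ _ _ _ (lexx _) F x0.
have [xl vl [l [lP rl [k lk] Wl]]] := flow_locks N_gt0 eta_le1 r01 h_small etaN F (lexx 0) Wr.
split=> //; exists l => //.
have lk1 : `|l - (1 - 2 * k%:R / N%:R)| <= r * e / 32 by apply: le_trans lk _.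
move: lk1; rewrite ler_norml => /andP[lk1 lk2].
have otherwise : R0' - eps < l.
  (* The initial error [4 eta1 N] plus the loss [2 eta1 N], divided by [N / 2]. *)
  have bl : R0' ^+ 2 - 12 * eta1 <= l ^+ 2.
    have N20 : 0 < N%:R / 2 :> R by rewrite divr_gt0.
    by rewrite -(ler_pM2l N20); lra.
  have rR : r <= R0' by rewrite /r; lra.
  have := sqr_gap l R0' (12 * eta1) rR rl bl; have -> : 12 * eta1 < r * e / 2 by lra.
  by move=> /(_ isT); lra.
rewrite /order_param_bound; case: eqP => [N2|/eqP N2].
  rewrite N2 in lk1 lk2.
  (* A larger [k] would make the quantized value nonpositive, against [l >= r]; for [N = 3] the same
     excludes [k >= 2]. *)
  have k0 : k = 0%N.
    apply/eqP; rewrite -leqn0 leqNgt; apply/negP => k0.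
    have : 1 <= k%:R :> R by rewrite ler1n.
    by lra.
  by rewrite k0 in lk1; lra.
case: eqP => [N3|/eqP N3] /=.
  rewrite N3 in lk1 lk2 *.
  have k1 : (k <= 1)%N.
    rewrite leqNgt; apply/negP => k1.
    have : 2 <= k%:R :> R by rewrite ler_nat.
    by lra.
  have : k%:R <= 1 :> R by rewrite lern1.
  by lra.
case: asboolP => // dist; move: general.
rewrite (asboolT dist) /= -leqNgt => N4.
(* Only [N = 1] is left, where the bound lies below -1 while [l] is positive. *)
have small M : (0 < M)%N -> M != 2%N -> M != 3%N -> (M <= 3)%N -> M = 1%N.
  by case: M => [|[|[|[|]]]].
have -> : 1 - 2 / N%:R - eps = - 1 - eps by rewrite (small N) //; field.
by lra.
Qed.

(** * Reduction to the centered flow *)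

Section Reduction.
Context (R : realType).
Implicit Types (t u e : R).

Lemma derivative_on_ge0_right_continuous (f df : R -> R) e :
  derivative_on_ge0 f df -> 0 < e -> \forall h \near 0^'+, `|f h - f 0| <= e.
Proof.
move=> [_ df0] e0.
have id0 : h @[h --> (0 : R)^'+] --> (0 : R) by apply: cvg_at_right_filter; exact: cvg_id.
have H : h * (h^-1 * (f h - f 0)) @[h --> (0 : R)^'+] --> 0 * df 0 by exact: cvgM.
rewrite mul0r in H; move/cvgrPdistC_le : H => /(_ _ e0) H.
near=> h; have h0 : 0 < h by near: h; exact: nbhs_right_gt.
have : `|h * (h^-1 * (f h - f 0)) - 0| <= e by near: h.
by rewrite subr0 mulrA mulfV ?mul1r // gt_eqF.
Unshelve. all: by end_near. Qed.

(** Two-sided derivatives are available only at positive times, so the flow is started at a small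
    [t0 > 0]; right continuity keeps the data there close to the initial data. *)
Lemma near_initial_time (n : nat) (f df g dg : 'I_n -> R -> R) e : 0 < e ->
  (forall i, derivative_on_ge0 (f i) (df i)) ->
  (forall i, derivative_on_ge0 (g i) (dg i)) ->
  exists2 t0, 0 < t0 & forall i, `|f i t0 - f i 0| <= e /\ `|g i t0 - g i 0| <= e.
Proof.
move=> e0 fP gP.
have H : \forall h \near (0 : R)^'+,
    forall i, `|f i h - f i 0| <= e /\ `|g i h - g i 0| <= e.
  apply: filter_forall => i.
  exact: filterI (derivative_on_ge0_right_continuous (fP i) e0)
    (derivative_on_ge0_right_continuous (gP i) e0).
have H0 : \forall h \near (0 : R)^'+, 0 < h by exact: nbhs_right_gt.
near (0 : R)^'+ => h; exists h; first by near: h.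
by near: h.
Unshelve. all: by end_near. Qed.

Lemma cvg_at_infty_affine (f : R -> R) (l t0 k : R) : 0 < k ->
  f t @[t --> +oo] --> l -> f ((t - t0) * k) @[t --> +oo] --> l.
Proof.
move=> k0 fl; apply: le_cvg_at_infty => e e0.
have [T T0 fT] := cvg_at_infty_le fl e0.
exists (Num.max 0 (t0 + T / k)); first by rewrite le_max lexx.
move=> t; rewrite ge_max => /andP[_ Tt]; apply: fT.
by rewrite -ler_pdivrMr // lerBrDl.
Qed.

Lemma derive0_constant (f df : R -> R) a : (forall t, a <= t -> is_derive t 1 f (df t)) ->
  (forall t, a <= t -> df t = 0) -> forall t, a <= t -> f t = f a.
Proof.
move=> fP df0 t at_; have [|c /andP[ac _]] := @mean_value _ f df a t at_.
  by move=> y /andP[ay _]; exact: fP.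
by rewrite (df0 _ ac) mul0r => /eqP; rewrite subr_eq0 => /eqP.
Qed.

(* The mean phase solves m M'' + M' = b, so that e^(t/m) (M' - b) and
   M - t b + m (M' - b) are constant. *)
Lemma mean_phase_drift (m b t0 : R) (M V A : R -> R) : 0 < m ->
  (forall t, t0 <= t -> is_derive t 1 M (V t)) ->
  (forall t, t0 <= t -> is_derive t 1 V (A t)) ->
  (forall t, t0 <= t -> m * A t + V t = b) ->
  V t @[t --> +oo] --> b /\ exists l, M t - t * b @[t --> +oo] --> (l : R).
Proof.
move=> m0 dM dV ode.
have AE t : t0 <= t -> A t = m^-1 * (b - V t).
  by move=> /ode <-; rewrite addrK mulrA mulVf ?mul1r // gt_eqF.
have c1 := @derive0_constant (fun t => expR (m^-1 * t) * (V t + - b))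
  (fun t => m^-1 * expR (m^-1 * t) * (V t + - b) + expR (m^-1 * t) * (A t + 0)) t0
  (fun t t0t => is_derive_mul (is_derive_expRc t m^-1)
    (is_derive_add (dV t t0t) (is_derive_cstE t (- b)))).
have {}c1 t : t0 <= t -> V t - b = expR (m^-1 * t0) * (V t0 - b) * expR (- (t * m^-1)).
  move=> t0t; rewrite -(c1 _ t t0t) //; last by move=> y /AE ->; ring.
  by rewrite mulrAC -expRD mulrC (mulrC t) subrr expR0 mulr1.
have c2 := @derive0_constant (fun t => (M t + m * (V t + - b)) + - (b * t))
  (fun t => (V t + m * (A t + 0)) + - (b * 1)) t0
  (fun t t0t => is_derive_add (is_derive_add (dM t t0t)
    (is_derive_mulc m (is_derive_add (dV t t0t) (is_derive_cstE t (- b)))))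
    (is_derive_opp (is_derive_mulc b (is_derive_idE t)))).
have {}c2 t : t0 <= t -> M t - t * b =
    (M t0 + m * (V t0 - b) - b * t0) - m * (V t - b).
  move=> t0t; rewrite -(c2 _ t t0t); first by ring.
  by move=> y y0; rewrite -(ode y y0); ring.
have e0 : expR (- (t * m^-1)) @[t --> +oo] --> (0 : R).
  have := @cvg_at_infty_affine (fun t => expR (- t)) 0 0 m^-1.
  by rewrite invr_gt0 => /(_ m0 (@cvgr_expR R)); under eq_fun do rewrite subr0.
have V0 : V t - b @[t --> +oo] --> (0 : R).
  apply: (@eq_cvg_at_infty _ (fun t => expR (m^-1 * t0) * (V t0 - b) * expR (- (t * m^-1)))
    _ _ t0); first by move=> t /c1 ->.
  rewrite -[X in _ --> X](mulr0 (expR (m^-1 * t0) * (V t0 - b))).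
  by apply: cvgM => //; exact: cvg_cst.
split.
  have H : (V t - b) + b @[t --> +oo] --> 0 + b by apply: cvgD => //; exact: cvg_cst.
  rewrite add0r in H.
  by apply: (@eq_cvg_at_infty _ _ _ _ 0 _ H) => t _; rewrite subrK.
exists (M t0 + m * (V t0 - b) - b * t0 - m * 0).
have H : M t0 + m * (V t0 - b) - b * t0 - m * (V t - b) @[t --> +oo] -->
    M t0 + m * (V t0 - b) - b * t0 - m * 0.
  by apply: cvgB; [exact: cvg_cst|apply: cvgM => //; exact: cvg_cst].
by apply: (@eq_cvg_at_infty _ _ _ _ t0 _ H) => t /c2 ->.
Qed.

(** * Centering by the mean phase *)

Section Mean.
Variable N : nat.
Hypothesis N_gt0 : (0 < N)%N.

Definition mean (f : 'I_N -> R) : R := N%:R^-1 * \sum_j f j.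

Lemma sum_centered (f : 'I_N -> R) : \sum_i (f i - mean f) = 0.
Proof.
rewrite sumrB sumr_const card_ord /mean -[_ *+ N]mulr_natl mulrA divff ?natN_neq0 //.
by rewrite mul1r subrr.
Qed.

Lemma mean_scale (a : R) (f : 'I_N -> R) : mean (fun i => a * f i) = a * mean f.
Proof. by rewrite /mean -mulr_sumr mulrCA. Qed.

Lemma mean_add (f g : 'I_N -> R) : mean (fun i => f i + g i) = mean f + mean g.
Proof. by rewrite /mean big_split mulrDr. Qed.

Lemma le_max_diff (f : 'I_N -> R) i j : `|f i - f j| <= max_diff f.
Proof.
rewrite /max_diff; apply: le_trans (le_bigmax _ _ i).
exact: (le_bigmax 0 (fun j => `|f i - f j|) j).
Qed.

Lemma centered_le_max_diff (f : 'I_N -> R) i : `|f i - mean f| <= max_diff f.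
Proof.
have -> : f i - mean f = N%:R^-1 * \sum_j (f i - f j).
  rewrite sumrB sumr_const card_ord /mean mulrBr -[f i *+ N]mulr_natl mulKf //.
  exact: natN_neq0.
by apply: normr_mean_le => // j; exact: le_max_diff.
Qed.

Lemma mean_derive (f df : 'I_N -> R -> R) t :
  (forall i, is_derive t 1 (f i) (df i t)) ->
  is_derive t 1 (fun s => mean (f^~ s)) (mean (df^~ t)).
Proof. by move=> fP; apply: is_derive_mulc; exact: is_derive_sumE. Qed.

(** The pulls are invariant under rotation and sum to 0, so subtracting from the equation its mean
    over the oscillators leaves them unchanged; dividing by [kappa] gives the flow equation in the
    time [kappa (t - t0)]. *)
Lemma kuramoto_centered_flow (eta m kappa t0 : R)
    (nu theta0 omega0 : 'I_N -> R) (theta dtheta ddtheta : 'I_N -> R -> R) :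
  0 < m -> 0 < kappa -> 0 < t0 -> m * kappa <= eta ->
  max_diff nu / kappa <= eta -> max_diff (dtheta^~ t0) / kappa <= 1 ->
  kuramoto_solution m kappa nu theta0 omega0 theta dtheta ddtheta ->
  centered_flow eta (m * kappa) (fun i => (nu i - mean nu) / kappa)
    (fun i s => theta i (t0 + s * kappa^-1) - mean (theta^~ (t0 + s * kappa^-1)))
    (fun i s => kappa^-1 * (dtheta i (t0 + s * kappa^-1) -
                            mean (dtheta^~ (t0 + s * kappa^-1))))
    (fun i s => kappa^-1 * (kappa^-1 * (ddtheta i (t0 + s * kappa^-1) -
                            mean (ddtheta^~ (t0 + s * kappa^-1))))).
Proof.
move=> m0 k0 t00 mk nuk dk [dT ddT ode _ _].
have ki0 : 0 < kappa^-1 by rewrite invr_gt0.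
have time (s : R) : 0 <= s -> 0 < t0 + s * kappa^-1.
  by move=> s0; rewrite ltr_wpDr // mulr_ge0 // ltW.
have centered_derive (f df : 'I_N -> R -> R) i (s : R) : (forall j, derivative_on_ge0 (f j) (df j)) -> 0 <= s ->
    is_derive s 1 (fun s => f i (t0 + s * kappa^-1) - mean (f^~ (t0 + s * kappa^-1)))
      (kappa^-1 * (df i (t0 + s * kappa^-1) - mean (df^~ (t0 + s * kappa^-1)))).
  move=> fP /time ts; have fi j := (fP j).1 _ ts.
  apply: (@is_derive_affine _ (fun t => f i t - mean (f^~ t))).
  exact: (is_derive_add (fi i) (is_derive_opp (mean_derive fi))).
split.
- exact: mulr_gt0.
- exact: mk.
- move=> i; rewrite normrM (gtr0_norm ki0) (le_trans _ nuk) //.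
  by rewrite ler_pM2r // centered_le_max_diff.
- move=> i; rewrite mul0r addr0 normrM (gtr0_norm ki0) mulrC (le_trans _ dk) //.
  by rewrite ler_pM2r // centered_le_max_diff.
- by move=> i s; exact: centered_derive.
- by move=> i s s0; apply: is_derive_mulc; exact: centered_derive.
- move=> i s s0; set T := t0 + s * kappa^-1.
  have T0 : 0 <= T by rewrite ltW // time.
  have odeT j : m * ddtheta j T + dtheta j T = nu j + kappa * pull (theta^~ T) j.
    by rewrite ode // pullE mulrA.
  have M : m * mean (ddtheta^~ T) + mean (dtheta^~ T) = mean nu.
    rewrite -mean_scale -mean_add /mean; under eq_bigr do rewrite odeT.
    by rewrite big_split /= -mulr_sumr sum_pull mulr0 addr0.
  rewrite (pull_addc (theta^~ T)).
  have -> : m * kappa * (kappa^-1 * (kappa^-1 * (ddtheta i T - mean (ddtheta^~ T)))) +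
    kappa^-1 * (dtheta i T - mean (dtheta^~ T)) = 
    ((m * ddtheta i T + dtheta i T) - (m * mean (ddtheta^~ T) + mean (dtheta^~ T))) / kappa.
    by field; rewrite gt_eqF.
  by rewrite odeT M; field; rewrite gt_eqF.
- by move=> s s0; exact: sum_centered.
Qed.

End Mean.
End Reduction.

Theorem theorem1p2 (R : realType) (N : nat) (theta0 : 'I_N -> R) (eps : R) :
  (1 <= N)%N -> 0 < order_param theta0 -> 0 < eps ->
  exists a b c : R, [/\ 0 < a, 0 < b & 0 < c] /\
  forall (omega0 : 'I_N -> R) (kappa m : R) (nu : 'I_N -> R),
    0 < kappa -> 0 < m ->
    max_diff nu / kappa < a ->
    max_diff omega0 / kappa < b ->
    m * kappa < c ->
  forall theta dtheta ddtheta : 'I_N -> R -> R,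
    kuramoto_solution m kappa nu theta0 omega0 theta dtheta ddtheta ->
    (exists thetaoo : 'I_N -> R, forall i : 'I_N,
       (theta i t - t / N%:R * \sum_(j < N) nu j) @[t --> +oo] --> thetaoo i /\
       dtheta i t @[t --> +oo] --> N%:R^-1 * \sum_(j < N) nu j) /\
    (exists Roo : R,
       order_param (fun j : 'I_N => theta j t) @[t --> +oo] --> Roo /\
       order_param_bound theta0 eps < Roo).
Proof.
move=> N_gt0 R0 eps0.
have [eta eta0 lock] := centered_flow_locking N_gt0 R0 eps0.
(* Up to [t0] each velocity may change by [kappa / 4], so [b = 1 / 2] keeps velocity differences at
   [t0] within [kappa / 2 + 2 kappa / 4 = kappa], as [flow_v0] requires after rescaling. *)
exists eta, (1 / 2), eta; split; first by split=> //; rewrite divr_gt0.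
move=> omega0 kappa m nu k0 m0 nuk omk mk theta dtheta ddtheta sol.
have [dT ddT ode th0 om0] := sol.
have [t0 t00 near0] : exists2 t0, 0 < t0 & forall i,
    `|theta i t0 - theta i 0| <= Num.min eta (kappa / 4) /\
    `|dtheta i t0 - dtheta i 0| <= Num.min eta (kappa / 4).
  by apply: near_initial_time dT ddT; rewrite lt_min eta0 divr_gt0.
have dk : max_diff (dtheta^~ t0) / kappa <= 1.
  rewrite ler_pdivrMr // mul1r; apply: bigmax_le; first exact: ltW.
  move=> i _; apply: bigmax_le; first exact: ltW.
  move=> j _; have [_] := near0 i; have [_] := near0 j.
  rewrite !om0 !le_min => /andP[_ dj] /andP[_ di].
  have dij := le_max_diff omega0 i j.
  rewrite ltr_pdivrMr // in omk.
  have -> : dtheta i t0 - dtheta j t0 = (dtheta i t0 - omega0 i) -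
    (dtheta j t0 - omega0 j) + (omega0 i - omega0 j) by ring.
  have h1 := ler_normD ((dtheta i t0 - omega0 i) - (dtheta j t0 - omega0 j)) (omega0 i - omega0 j).
  have h2 := ler_normB (dtheta i t0 - omega0 i) (dtheta j t0 - omega0 j).
  by lra.
have F := kuramoto_centered_flow N_gt0 m0 k0 t00 (ltW mk) (ltW nuk) dk sol.
have [|xl vl [Roo RP bound]] := lock _ (- mean (theta^~ t0)) _ _ _ _ F.
  move=> i /=; rewrite mul0r addr0 opprD addrACA subrr addr0 -th0.
  by have [+ _] := near0 i; rewrite le_min => /andP[].
have time (t : R) : t0 + (t - t0) * kappa * kappa^-1 = t.
  by rewrite mulfK ?gt_eqF // addrC subrK.
(* The mean phase, removed by centering, is recovered from its own linear equation. *)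
have odeM t : t0 <= t -> m * mean (ddtheta^~ t) + mean (dtheta^~ t) = mean nu.
  move=> t0t; rewrite -mean_scale -mean_add /mean.
  have t_ge0 := le_trans (ltW t00) t0t.
  under eq_bigr => j _ do rewrite (ode j t t_ge0) -mulrA -pullE.
  by rewrite big_split /= -mulr_sumr sum_pull mulr0 addr0.
have [drift [lM lMP]] := @mean_phase_drift R m (mean nu) t0
  (fun t => mean (theta^~ t)) (fun t => mean (dtheta^~ t)) (fun t => mean (ddtheta^~ t)) m0
  (fun t t0t => mean_derive (fun i => (dT i).1 t (lt_le_trans t00 t0t)))
  (fun t t0t => mean_derive (fun i => (ddT i).1 t (lt_le_trans t00 t0t))) odeM.
split; last first.
  exists Roo; split=> //.
  apply: (@eq_cvg_at_infty _ _ _ _ 0 _ (cvg_at_infty_affine t0 k0 RP)) => t _.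
  by rewrite (order_param_addc (theta^~ _)) time.
have /choice[xoo xP] := xl.
exists (fun i => xoo i + lM) => i; split.
- have H : (theta i (t0 + (t - t0) * kappa * kappa^-1) -
      mean (theta^~ (t0 + (t - t0) * kappa * kappa^-1))) +
      (mean (theta^~ t) - t * mean nu) @[t --> +oo] --> xoo i + lM.
    by apply: cvgD => //; exact: (cvg_at_infty_affine t0 k0 (xP i)).
  apply: (@eq_cvg_at_infty _ _ _ _ 0 _ H) => t _.
  by rewrite time /mean; ring.
- have H : kappa * (kappa^-1 * (dtheta i (t0 + (t - t0) * kappa * kappa^-1) -
      mean (dtheta^~ (t0 + (t - t0) * kappa * kappa^-1)))) +
      mean (dtheta^~ t) @[t --> +oo] --> kappa * 0 + mean nu.
    apply: cvgD => //; apply: cvgM; first exact: cvg_cst.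
    exact: (cvg_at_infty_affine t0 k0 (vl i)).
  rewrite mulr0 add0r in H.
  apply: (@eq_cvg_at_infty _ _ _ _ 0 _ H) => t _.
  by rewrite time mulVKf ?gt_eqF // subrK.
Qed.
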